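(* Let $n\ge2$ and consider the family of displaced thermal states $\mathcal Q_n=\{\rho_{z,N}^{\otimes n}:z\in\mathbb C,\ N>0\}$ on $\mathcal H^{\otimes n}$. The total residual photon-number measurement $$M_n^\star(\{s\}):=U_n^\dagger\bigl(I\otimes\Pi_s^{(n-1)}\bigr)U_n,\qquad s\in\mathbb N_0,$$ is quantum-to-classically sufficient for $\mathcal Q_n$ relative to the class $\mathfrak M_{\mathrm{inv}}^{(n)}$ of collective-displacement invariant POVMs. More precisely, for every $M\in\mathfrak M_{\mathrm{inv}}^{(n)}$ with outcome space $(\mathsf Y,\mathcal Y)$ there exists a parameter-independent Markov kernel $K_M:\mathbb N_0\times\mathcal Y\to[0,1]$ such that $$\operatorname{Tr}[\rho_{z,N}^{\otimes n}M(B)]=\sum_{s=0}^\infty K_M(s,B)\operatorname{Tr}[\rho_{z,N}^{\otimes n}M_n^\star(\{s\})]\qquad\text{for all }z\in\mathbb C,\ N>0,\ B\in\mathcal Y.$$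
   Context: **States.** $\mathcal H=L^2(\mathbb R)$ with number (Hermite) basis $\{|k\rangle\}_{k\ge0}$, annihilation operator $a$ ($a|k\rangle=\sqrt k|k-1\rangle$), and displacement operators $D(z)=\exp(za^\dagger-\bar za)$, $z\in\mathbb C$. The thermal state with mean photon number $N>0$ is $\phi_N=\frac1{N+1}\sum_{k\ge0}\bigl(\frac N{N+1}\bigr)^k|k\rangle\langle k|$, and $\rho_{z,N}=D(z)\phi_ND(z)^\dagger$. **Concentrating unitary.** $U_n$ is a fixed passive (total-photon-number preserving) unitary on $\mathcal H^{\otimes n}$ such that for all $z,w\in\mathbb C$, $N>0$: $U_n\rho_{z,N}^{\otimes n}U_n^\dagger=\rho_{\sqrt n\,z,N}\otimes\phi_N^{\otimes(n-1)}$ and $U_nD(w)^{\otimes n}U_n^\dagger=D(\sqrt n\,w)\otimes I^{\otimes(n-1)}$. Such a unitary exists. **Number projections.** For $m\ge1$, $\Pi_s^{(m)}=\sum_{k\in\mathbb N_0^m,\,k_1+\dots+k_m=s}|k_1\rangle\langle k_1|\otimes\dots\otimes|k_m\rangle\langle k_m|$ on $\mathcal H^{\otimes m}$. **POVMs and sufficiency.** A POVM $M$ with (standard Borel) outcome space $(\mathsf Y,\mathcal Y)$ is a map from $\mathcal Y$ to positive bounded operators, countably additive in the weak operator topology, with $M(\mathsf Y)=I$. A POVM on $\mathcal H^{\otimes n}$ is collective-displacement invariant if $(D(w)^{\otimes n})^\dagger M(B)D(w)^{\otimes n}=M(B)$ for all $w\in\mathbb C$ and $B$; $\mathfrak M_{\mathrm{inv}}^{(n)}$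 is the class of such POVMs. A measurement $M^\star$ in a class $\mathfrak M$ of POVMs is *quantum-to-classically sufficient* for a family of states relative to $\mathfrak M$ if $M^\star\in\mathfrak M$ and for every $M\in\mathfrak M$ there is a parameter-independent Markov kernel from the outcome space of $M^\star$ to that of $M$ carrying the outcome law of $M^\star$ to that of $M$ under every state of the family. *)

(* Defs.v *)
From HB Require Import structures.
From mathcomp Require Import all_boot all_order all_algebra.
From mathcomp Require Import complex ring.
From mathcomp Require Import all_classical all_reals all_analysis.

Set Implicit Arguments.
Unset Strict Implicit.
Unset Printing Implicit Defensive.

Import Order.TTheory GRing.Theory Num.Theory.
Import numFieldNormedType.Exports.

Local Open Scope classical_set_scope.
Local Open Scope complex_scope.
Local Open Scope ring_scope.

(* H = L^2(R) is represented in its number (Hermite) basis, as l^2(nat), and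
   its n-th tensor power as l^2 of the n-tuples of photon numbers, the tuple
   k standing for |k_1> (x) ... (x) |k_n>. *)

(* The value is only meaningful for absolutely summable families. *)
Definition rsum (R : realType) (I : choiceType) (f : I -> R) : R :=
  fine (\esum_(i in [set: I]) (Num.max (f i) 0)%:E
        - \esum_(i in [set: I]) (Num.max (- f i) 0)%:E)%E.

Definition csum (R : realType) (I : choiceType) (f : I -> R[i]) : R[i] :=
  (rsum (fun i => complex.Re (f i)) +i* rsum (fun i => complex.Im (f i)))%C.

Section HilbertSpace.
Variables (R : realType) (I : choiceType).

Definition sqsum (u : I -> R[i]) : \bar R :=
  (\esum_(i in [set: I]) (ComplexField.Normc.normc (u i) ^+ 2)%:E)%E.

Definition square_summable : {pred I -> R[i]} :=
  [pred u | (sqsum u < +oo)%E].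

Record ell2 := Ell2 {
  ell2_fun :> I -> R[i];
  _ : ell2_fun \in square_summable }.

HB.instance Definition _ := [isSub for ell2_fun].
HB.instance Definition _ := [Choice of ell2 by <:].

Lemma normc_sqr (z : R[i]) :
  ComplexField.Normc.normc z ^+ 2 = complex.Re z ^+ 2 + complex.Im z ^+ 2.
Proof. by case: z => a b /=; rewrite sqr_sqrtr// addr_ge0// sqr_ge0. Qed.

Lemma square_summable_submod : submod_closed square_summable.
Proof.
have sq0 (u : I -> R[i]) i :
    (0 <= (ComplexField.Normc.normc (u i) ^+ 2)%:E)%E.
  by rewrite lee_fin sqr_ge0.
split.
  rewrite inE; rewrite /sqsum esum1 => [|i _]; first exact: ltry.
  by rewrite normc_sqr /= expr0n addr0.
move=> a u v; rewrite !inE => ul vl.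
pose A := 2 * ComplexField.Normc.normc a ^+ 2.
have A0 : 0 <= A by rewrite mulr_ge0// sqr_ge0.
have sqZ c (w : I -> R[i]) : 0 <= c -> (sqsum w < +oo)%E ->
    (\esum_(i in [set: I])
      (c * ComplexField.Normc.normc (w i) ^+ 2)%:E < +oo)%E.
  move=> c0 wl.
  apply: (@le_lt_trans _ _ (c%:E * sqsum w)%E); last first.
    by rewrite lte_mul_pinfty// ?lee_fin.
  apply: ge_ereal_sup => _ [X [finX XT] <-].
  rewrite (eq_fsbigr (fun i =>
    (c%:E * (ComplexField.Normc.normc (w i) ^+ 2)%:E)%E)); last first.
    by move=> i _; rewrite EFinM.
  rewrite -ge0_mule_fsumr; last by move=> i; exact: sq0.
  apply: lee_wpmul2l; first by rewrite lee_fin.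
  by apply: ereal_sup_ubound; exists X.
apply: (@le_lt_trans _ _ (\esum_(i in [set: I])
   ((A * ComplexField.Normc.normc (u i) ^+ 2)%:E
    + (2 * ComplexField.Normc.normc (v i) ^+ 2)%:E))%E); last first.
  rewrite esumD; [|by move=> i _; rewrite lee_fin mulr_ge0// sqr_ge0..].
  by apply: lte_add_pinfty; exact: sqZ.
apply: le_esum => i _; rewrite -EFinD lee_fin /A.
rewrite !normc_sqr (_ : (a *: u + v) i = a * u i + v i)//=.
case: a {A A0} => a1 a2; case: (u i) => u1 u2; case: (v i) => v1 v2 /=.
rewrite -subr_ge0 (_ : _ - _ =
  (a1 * u1 - a2 * u2 - v1) ^+ 2 + (a1 * u2 + a2 * u1 - v2) ^+ 2).
  by rewrite addr_ge0// sqr_ge0.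
by ring.
Qed.

HB.instance Definition _ :=
  GRing.isSubmodClosed.Build _ _ square_summable square_summable_submod.
HB.instance Definition _ := [SubChoice_isSubLmodule of ell2 by <:].

Lemma ket_subproof (i : I) :
  (fun j : I => (j == i)%:R : R[i]) \in square_summable.
Proof.
rewrite inE.
rewrite /sqsum (esumID [set i]); last by move=> j _; rewrite lee_fin sqr_ge0.
rewrite !setTI esum_set1 ?lee_fin ?sqr_ge0// [X in (_ + X)%E]esum1.
  by rewrite adde0 ltry.
move=> j ji; rewrite normc_sqr; have /negPf -> : j != i by exact/eqP.
by rewrite /= expr0n addr0.
Qed.

Definition ket (i : I) : ell2 := Ell2 (ket_subproof i).

(* linear in the second argument *)
Definition inner (u v : ell2) : R[i] := csum (fun i => (u i)^*%C * v i).

Definition hnorm (u : ell2) : R := Num.sqrt (fine (sqsum u)).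

Definition op := ell2 -> ell2.

Definition bounded_op (A : op) : Prop :=
  (forall (a : R[i]) (u v : ell2), A (a *: u + v) = a *: A u + A v) /\
  exists c : R, forall u, hnorm (A u) <= c * hnorm u.

(* The bounded operator with matrix elements <i|A|j> = m i j; it is unique
   when it exists, and the zero operator is returned when it does not. *)
Definition op_of_mx (m : I -> I -> R[i]) : op :=
  xget (fun=> 0) [set A : op |
    bounded_op A /\ forall i j, inner (ket i) (A (ket j)) = m i j].

Definition adj (A : op) : op :=
  xget (fun=> 0) [set B : op | forall u v, inner (B u) v = inner u (A v)].

Definition unitary (U : op) : Prop :=
  [/\ bounded_op U, adj U \o U = id & U \o adj U = id].

Definition positive_op (A : op) : Prop := forall u, 0 <= inner u (A u).

Definition trace (A : op) : R[i] := csum (fun i => inner (ket i) (A (ket i))).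

End HilbertSpace.

Section Modes.
Variable R : realType.

Definition modes (n : nat) := op R (n.-tuple nat).

Definition annihilate (f : nat -> R[i]) : nat -> R[i] :=
  fun k => (Num.sqrt k.+1%:R)%:C * f k.+1.

Definition create (f : nat -> R[i]) : nat -> R[i] :=
  fun k => (Num.sqrt k%:R)%:C * f k.-1.

Definition displacement_gen (z : R[i]) (f : nat -> R[i]) : nat -> R[i] :=
  fun k => z * create f k - z^*%C * annihilate f k.

(* D(z) = exp(z a^* - conj(z) a): the number states are entire vectors of the
   generator, so that D(z)|k> is the sum of the exponential series
   (z a^* - conj(z) a)^m |k> / m!, whose terms are finite combinations of
   number states. *)
Definition displacement (z : R[i]) : op R nat :=
  op_of_mx (fun j k =>
    csum (fun m : nat => iter m (displacement_gen z) (ket R k) j / m`!%:R)).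

Definition thermal (N : R) : op R nat :=
  op_of_mx (fun j k => (j == k)%:R * ((N + 1)^-1 * (N / (N + 1)) ^+ k)%:C).

Definition displaced_thermal (z : R[i]) (N : R) : op R nat :=
  displacement z \o thermal N \o adj (displacement z).

Definition tensor_power (n : nat) (A : op R nat) : modes n :=
  op_of_mx (fun k l : n.-tuple nat =>
    \prod_(i < n) inner (ket R (tnth k i)) (A (ket R (tnth l i)))).

Arguments tensor_power : clear implicits.

(* A (x) B, with A on the first mode and B on the other n - 1; used for n > 0. *)
Definition tensor_first (n : nat) (A : op R nat) (B : modes n.-1) : modes n :=
  op_of_mx (fun k l : n.-tuple nat =>
    inner (ket R (head 0%N k)) (A (ket R (head 0%N l))) *
    inner (ket R [tuple of behead k]) (B (ket R [tuple of behead l]))).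

(* The sum of the projections Pi_s for s in S; Pi_s itself is S = [set s]. *)
Definition number_proj (m : nat) (S : set nat) : modes m :=
  op_of_mx (fun k l : m.-tuple nat =>
    ((k == l) && `[< S (\sum_(i < m) tnth k i)%N >])%:R).

Arguments number_proj : clear implicits.

(* U_n: passive unitary that concentrates the displacement in the first mode *)
Definition concentrating (n : nat) (U : modes n) : Prop :=
  [/\ unitary U,
      forall s, U \o number_proj n [set s] = number_proj n [set s] \o U,
      forall (z : R[i]) (N : R), 0 < N ->
        U \o tensor_power n (displaced_thermal z N) \o adj U =
        tensor_first (displaced_thermal ((Num.sqrt n%:R)%:C * z) N)
                     (tensor_power n.-1 (thermal N)) &
      forall w : R[i],
        U \o tensor_power n (displacement w) \o adj U =
        tensor_first (displacement ((Num.sqrt n%:R)%:C * w)) id].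

Definition displaced_thermal_family (n : nat) : set (modes n) :=
  [set rho | exists (z : R[i]) (N : R),
    0 < N /\ rho = tensor_power n (displaced_thermal z N)].

Definition residual_number (n : nat) (U : modes n) (S : set nat) : modes n :=
  adj U \o tensor_first id (number_proj n.-1 S) \o U.

End Modes.

Arguments tensor_power {R} n A.
Arguments number_proj {R} m S.
Arguments tensor_first {R n} A B.
Arguments displaced_thermal_family {R} n.

(* The sigma-algebra is the Borel algebra of a complete separable metric. *)
Definition standard_borel (R : realType) d (Y : measurableType d) : Prop :=
  exists dist : Y -> Y -> R,
  [/\ (forall x y, dist x y = 0 <-> x = y) /\
      (forall x y, dist x y = dist y x) /\
      (forall x y z, dist x z <= dist x y + dist y z),
      forall x : nat -> Y,
        (forall e : R, 0 < e -> exists N : nat, forall i j : nat,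
          (N <= i)%N -> (N <= j)%N -> dist (x i) (x j) < e) ->
        exists y : Y, forall e : R, 0 < e -> exists N : nat, forall i : nat,
          (N <= i)%N -> dist (x i) y < e,
      exists2 D : set Y, countable D &
        forall (x : Y) (e : R), 0 < e -> exists2 y, D y & dist x y < e &
      @measurable d Y =
        <<s [set V : set Y | forall x, V x ->
          exists2 e : R, 0 < e & [set y | dist x y < e] `<=` V] >>].

Section Measurements.
Variables (R : realType) (I : choiceType).

Definition povm d (Y : measurableType d) (M : set Y -> op R I) : Prop :=
  [/\ standard_borel R Y,
      forall B, measurable B -> bounded_op (M B) /\ positive_op (M B),
      M [set: Y] = id &
      forall F : nat -> set Y, (forall i, measurable (F i)) ->
        trivIset [set: nat] F -> forall u v : ell2 R I,
        series (fun i => (inner u (M (F i) v) : R[i]^o)) @ \oo -->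
          (inner u (M (\bigcup_i F i) v) : R[i]^o)].

Definition povm_class :=
  forall d (Y : measurableType d), (set Y -> op R I) -> Prop.

Definition outcome_law (rho : op R I) d (Y : measurableType d)
    (M : set Y -> op R I) (mu : probability Y R) : Prop :=
  forall B, measurable B -> trace (rho \o M B) = (fine (mu B))%:C.

Definition qc_sufficient (Q : set (op R I)) (C : povm_class)
    d (X : measurableType d) (Mstar : set X -> op R I) : Prop :=
  C d X Mstar /\
  forall d' (Y : measurableType d') (M : set Y -> op R I), C d' Y M ->
  exists K : R.-pker X ~> Y, forall rho, Q rho ->
  exists (mu : probability X R) (nu : probability Y R),
    [/\ outcome_law rho Mstar mu, outcome_law rho M nu &
        forall B, measurable B -> nu B = (\int[mu]_x K x B)%E].

End Measurements.

Definition invariant_povm (R : realType) (n : nat) :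
    povm_class R (n.-tuple nat) :=
  fun d (Y : measurableType d) M =>
    povm M /\ forall (w : R[i]) (B : set Y), measurable B ->
      adj (tensor_power n (displacement w)) \o M B
        \o tensor_power n (displacement w) = M B.

(* Main.v *)
(* Conjugating an invariant POVM by U turns invariance under D(w)^{(x)n} into
   commutation with D(w) (x) I for all w; differentiating at w = 0 gives
   commutation with the ladder operators of the first mode, so the diagonal
   elements <x, t| U M(B) U^* |x, t> do not depend on the photon number x of
   that mode.  The displaced thermal state is, up to U, a displacement in the
   first mode of a diagonal operator whose weights depend on the residual tuple
   t only through its total s; hence Tr[rho M(B)] = sum_s Pr[s] K(s, B), with
   K(s, B) the average of <0, t| U M(B) U^* |0, t> over the tuples t with s
   photons. *)
Require Import Defs.
From HB Require Import structures.
From mathcomp Require Import all_boot all_order all_algebra.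
From mathcomp Require Import finmap complex ring lra zify.
From mathcomp Require Import all_classical all_reals all_analysis.
From mathcomp Require Import measurable_realfun.
Import Order.TTheory GRing.Theory Num.Theory.
Import numFieldNormedType.Exports.
Local Open Scope classical_set_scope.
Local Open Scope complex_scope.
Local Open Scope ring_scope.
Set Implicit Arguments.
Unset Strict Implicit.
Unset Printing Implicit Defensive.

(** The ladder operators are unbounded, and the exponential series of the generator is available
    only on number states, column by column. That it defines a bounded operator has to be proved
    first, because [displacement] is a choice that falls back to the zero operator; orthonormality
    of the columns provides the operator. For the same reason the derivative at w = 0 is taken on
    matrix elements between number states, with a second-order remainder, and never as an operator
    identity. The relation obtained is only real-linear in w; the directions w = 1 and w = i
    separate its creation part from its annihilation part. Traces and inner products are infinite
    sums of infinite sums, so interchanges go through one Fubini lemma with an explicit bound on the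
    absolute sums. The sectors of tuples with s photons are finite, and nonempty because n >= 2;
    given s, the tuple is uniform on its sector whatever N is, which frees the kernel from the
    parameters. *)

Section ComplexModulus.
Variable R : realType.
Implicit Types x y : R[i].
Local Notation nc := (@ComplexField.Normc.normc R).

Lemma nc_ge0 x : 0 <= nc x.
Proof. by case: x => a b; rewrite sqrtr_ge0. Qed.

Lemma ncM x y : nc (x * y) = nc x * nc y.
Proof. exact: ComplexField.Normc.normcM. Qed.

Lemma ncD x y : nc (x + y) <= nc x + nc y.
Proof. exact: le_normcD. Qed.

Lemma ncN x : nc (- x) = nc x.
Proof. by case: x => a b /=; rewrite !sqrrN. Qed.

Lemma nc_distC x y : nc (x - y) = nc (y - x).
Proof. by rewrite -ncN opprB. Qed.

Lemma ncJ x : nc (conjc x) = nc x.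
Proof. by case: x => a b /=; rewrite sqrrN. Qed.

Lemma nc0 : nc 0 = 0.
Proof. exact: ComplexField.Normc.normc0. Qed.

Lemma nc1 : nc 1 = 1.
Proof. exact: ComplexField.Normc.normc1. Qed.

Lemma ncR (a : R) : nc a%:C = `|a|.
Proof. by rewrite /= expr0n addr0 sqrtr_sqr. Qed.

Lemma ncX x k : nc (x ^+ k) = nc x ^+ k.
Proof. by elim: k => [|k IH]; rewrite ?expr0 ?nc1// !exprS ncM IH. Qed.

Lemma nc_eq0 x : nc x = 0 -> x = 0.
Proof. exact: ComplexField.Normc.eq0_normc. Qed.

Lemma nc_sum (J : Type) (r : seq J) (P : pred J) (f : J -> R[i]) :
  nc (\sum_(j <- r | P j) f j) <= \sum_(j <- r | P j) nc (f j).
Proof.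
elim/big_ind2: _ => [|a b c d ab cd|//]; first by rewrite nc0.
by apply: (le_trans (ncD _ _)); exact: lerD.
Qed.

Lemma nc_Re x : `|complex.Re x| <= nc x.
Proof.
by case: x => a b /=; rewrite -sqrtr_sqr ler_wsqrtr// lerDl sqr_ge0.
Qed.

Lemma nc_eq0_le x : (forall e : R, 0 < e -> nc x <= e) -> x = 0.
Proof.
move=> h; apply: nc_eq0; apply/eqP; rewrite eq_le nc_ge0 andbT.
by apply/ler_addgt0Pr => e e0; rewrite add0r h.
Qed.

Lemma conjcM_nc x : conjc x * x = (nc x ^+ 2)%:C.
Proof.
rewrite normc_sqr; case: x => a b /=; simpc; congr (_ +i* _)%C; ring.
Qed.

Lemma conjcD x y : conjc (x + y) = conjc x + conjc y.
Proof. exact: (rmorphD (@conjc R)). Qed.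

Lemma conjcM x y : conjc (x * y) = conjc x * conjc y.
Proof. exact: (rmorphM (@conjc R)). Qed.

Lemma conjcN x : conjc (- x) = - conjc x.
Proof. exact: (rmorphN (@conjc R)). Qed.

Lemma complexD_Re x y : complex.Re (x + y) = complex.Re x + complex.Re y.
Proof. by case: x; case: y. Qed.

End ComplexModulus.

Arguments ComplexField.Normc.normc : simpl never.
Arguments conjc : simpl never.
Arguments csum : simpl never.
Arguments inner : simpl never.
Arguments trace : simpl never.

(** * Unconditional sums *)

Section Sums.
Variable R : realType.
Local Notation C := R[i].
Local Notation nc := (@ComplexField.Normc.normc R).

(** Convergence along the net of finite index sets. Since [csum] is total and meaningless without
    summability, identities between sums are proved for [has_sum] and concluded by uniqueness. *)
Definition has_sum (I : choiceType) (f : I -> C) (s : C) : Prop :=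
  forall e : R, 0 < e -> exists X : {fset I}, forall Y : {fset I},
    (X `<=` Y)%fset -> nc (\sum_(i <- Y) f i - s) <= e.

(** Absolute summability with an explicit constant, so that bounds can be multiplied and passed to
    rows and columns. *)
Definition sum_bound (I : choiceType) (f : I -> C) (c : R) : Prop :=
  forall X : {fset I}, \sum_(i <- X) nc (f i) <= c.

Section OneIndex.
Variable I : choiceType.
Implicit Types (f g : I -> C) (s t : C) (c : R) (X Y : {fset I}).

Lemma fsum_subset (g : I -> R) X Y : (forall i, 0 <= g i) -> (X `<=` Y)%fset ->
  \sum_(i <- X) g i <= \sum_(i <- Y) g i.
Proof.
move=> g0 XY; rewrite [leRHS](bigID (fun i => i \in X)) /=.
rewrite (_ : \sum_(i <- Y | i \in X) g i = \sum_(i <- X) g i); last first.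
  rewrite -big_filter; apply: perm_big; apply: uniq_perm => //.
    by rewrite filter_uniq.
  move=> i; rewrite mem_filter; case: (boolP (i \in X)) => //= iX.
  exact: (fsubsetP XY).
by rewrite lerDl sumr_ge0.
Qed.

Lemma fsumID (V : nmodType) (g : I -> V) X Y : (X `<=` Y)%fset ->
  \sum_(i <- Y) g i = \sum_(i <- X) g i + \sum_(i <- (Y `\` X)%fset) g i.
Proof.
move=> XY; rewrite (bigID (fun i => i \in X)) /=; congr (_ + _).
  rewrite -big_filter; apply: perm_big; apply: uniq_perm => //.
    by rewrite filter_uniq.
  move=> i; rewrite mem_filter; case: (boolP (i \in X)) => //= iX.
  exact: (fsubsetP XY).
rewrite -big_filter; apply: perm_big; apply: uniq_perm => //.
  by rewrite filter_uniq.
by move=> i; rewrite mem_filter in_fsetD.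
Qed.

Lemma has_sum_unique f s t : has_sum f s -> has_sum f t -> s = t.
Proof.
move=> fs ft; apply/eqP; rewrite -subr_eq0; apply/eqP/nc_eq0_le => e e0.
have e2 : 0 < e / 2 by lra.
have [X hX] := fs _ e2; have [Y hY] := ft _ e2.
have := hX (X `|` Y)%fset (fsubsetUl _ _).
have := hY (X `|` Y)%fset (fsubsetUr _ _).
set S := \sum_(i <- _) f i => h1 h2.
rewrite (_ : s - t = (S - t) - (S - s)); last by ring.
by apply: (le_trans (ncD _ _)); rewrite ncN; lra.
Qed.

Lemma eq_has_sum f g s : f =1 g -> has_sum f s -> has_sum g s.
Proof. by move=> /funext ->. Qed.

Lemma has_sumD f g s t : has_sum f s -> has_sum g t ->
  has_sum (fun i => f i + g i) (s + t).
Proof.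
move=> fs gt e e0; have e2 : 0 < e / 2 by lra.
have [X hX] := fs _ e2; have [Y hY] := gt _ e2.
exists (X `|` Y)%fset => Z; rewrite fsubUset => /andP[XZ YZ].
have := hX _ XZ; have := hY _ YZ; rewrite big_split /=.
set S := \sum_(i <- Z) f i; set T := \sum_(i <- Z) g i => h1 h2.
rewrite (_ : S + T - _ = (S - s) + (T - t)); last by ring.
by apply: (le_trans (ncD _ _)); lra.
Qed.

Lemma has_sumZ (a : C) f s : has_sum f s -> has_sum (fun i => a * f i) (a * s).
Proof.
move=> fs e e0; have a0 := nc_ge0 a.
(* The [+ 1] avoids a separate case for [a = 0]. *)
have ea : 0 < e / (nc a + 1) by apply: divr_gt0 => //; lra.
have [X hX] := fs _ ea; exists X => Y XY.
rewrite -big_distrr /= -mulrBr ncM.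
apply: (@le_trans _ _ (nc a * (e / (nc a + 1)))).
  by rewrite ler_wpM2l// hX.
rewrite mulrA ler_pdivrMr; last by lra.
by rewrite mulrC ler_wpM2l//; lra.
Qed.

Lemma has_sumJ f s : has_sum f s -> has_sum (fun i => (f i)^*%C) (s^*)%C.
Proof.
move=> fs e e0; have [X hX] := fs _ e0; exists X => Y XY.
by rewrite -rmorph_sum /= -rmorphB ncJ hX.
Qed.

Lemma has_sum_fin f X : (forall i, i \notin X -> f i = 0) ->
  has_sum f (\sum_(i <- X) f i).
Proof.
move=> f0 e e0; exists X => Y XY; rewrite (fsumID f XY).
rewrite [X in _ + X - _]big1_seq ?addr0 ?subrr ?nc0 ?(ltW e0)//.
by move=> i /=; rewrite in_fsetD => /andP[/f0].
Qed.

Lemma has_sum0 : has_sum (fun _ : I => 0) 0.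
Proof.
have := @has_sum_fin (fun=> 0) fset0; rewrite big_seq_fset0.
by apply.
Qed.

Lemma has_sum1 f i : (forall j, j != i -> f j = 0) -> has_sum f (f i).
Proof.
move=> f0; have := @has_sum_fin f [fset i]%fset; rewrite big_seq_fset1.
by apply=> j; rewrite inE => /f0.
Qed.

Lemma has_sum_sum (J : Type) (r : seq J) (F : J -> I -> C) (S : J -> C) :
  (forall j, has_sum (F j) (S j)) ->
  has_sum (fun i => \sum_(j <- r) F j i) (\sum_(j <- r) S j).
Proof.
move=> h; elim: r => [|j r IH].
  by rewrite big_nil; apply: eq_has_sum has_sum0 => i; rewrite big_nil.
rewrite big_cons; apply: eq_has_sum (has_sumD (h j) IH) => i.
by rewrite big_cons.
Qed.

Lemma has_sum_le f s c : sum_bound f c -> has_sum f s -> nc s <= c.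
Proof.
move=> fc fs; apply/ler_addgt0Pr => e e0; have [X /(_ X (fsubset_refl _))] := fs _ e0.
set S := \sum_(i <- X) f i => h.
rewrite (_ : s = S - (S - s)); last by ring.
apply: (le_trans (ncD _ _)); rewrite ncN lerD//.
exact: (le_trans (nc_sum _ _ _)).
Qed.

(** Some finite set comes within [e] of the supremum, and by monotonicity every larger finite set
    stays there. *)
Lemma has_sum_nonneg (g : I -> R) c : (forall i, 0 <= g i) ->
  (forall X, \sum_(i <- X) g i <= c) ->
  let S := \esum_(i in [set: I]) (g i)%:E in
  [/\ S \is a fin_num & has_sum (fun i => (g i)%:C) (fine S)%:C].
Proof.
move=> g0 gc S.
have Sle X : ((\sum_(i <- X) g i)%:E <= S)%E.
  apply: ereal_sup_ubound; exists [set` X]; first by split.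
  by rewrite fsbig_finite//= set_fsetK sumEFin.
have Sc : (S <= c%:E)%E.
  apply: ge_ereal_sup => _ [A [finA _] <-].
  by rewrite fsbig_finite//= sumEFin lee_fin.
have S0 : (0 <= S)%E by apply: esum_ge0 => i _; rewrite lee_fin.
have Sfin : S \is a fin_num.
  by rewrite ge0_fin_numE// (le_lt_trans Sc)// ltry.
split=> // e e0.
have [_ [A [finA _] <-]] := ub_ereal_sup_adherent e0 Sfin.
rewrite fsbig_finite//= sumEFin -[ereal_sup _]/S => h.
have {}h : fine S - e < \sum_(i <- fset_set A) g i.
  by rewrite -lte_fin EFinB fineK.
exists (fset_set A) => Y AY.
rewrite -rmorph_sum -rmorphB ncR.
have h1 : \sum_(i <- Y) g i <= fine S.
  by rewrite -lee_fin fineK.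
have h2 := fsum_subset g0 AY.
rewrite distrC ger0_norm; last by rewrite subr_ge0.
by lra.
Qed.

(** The positive and negative parts of the real and imaginary parts are all dominated by the
    modulus, so each of the four sums that make up [csum] is finite. *)
Lemma csumP f c : sum_bound f c -> has_sum f (csum f).
Proof.
move=> fc.
have nn (h : I -> R) : (forall i, `|h i| <= nc (f i)) ->
    has_sum (fun i => (h i)%:C) (rsum h)%:C.
  move=> hf.
  have part (h' : I -> R) : (forall i, `|h' i| <= nc (f i)) ->
      let S := \esum_(i in [set: I]) (Num.max (h' i) 0)%:E in
      [/\ S \is a fin_num & has_sum (fun i => (Num.max (h' i) 0)%:C) (fine S)%:C].
    move=> h'f; apply: (@has_sum_nonneg _ c) => [i|X].
      by rewrite le_max lexx orbT.
    apply: le_trans (fc X); apply: ler_sum => i _; apply: le_trans (h'f i).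
    by rewrite ge_max normr_ge0 ler_norm.
  have [Sf1 S1] := part h hf.
  have [|Sf2 S2] := part (fun i => - h i); first by move=> i; rewrite normrN.
  rewrite /rsum fineB// rmorphB -mulN1r.
  apply: eq_has_sum (has_sumD S1 (has_sumZ (-1) S2)) => i.
  rewrite mulN1r -rmorphB; congr (_%:C).
  rewrite /Num.max; case: ltP => h1; case: ltP => h2; lra.
have im x : `|complex.Im x| <= nc x.
  by case: x => a b /=; rewrite -sqrtr_sqr ler_wsqrtr// lerDr sqr_ge0.
have h1 := nn (fun i => complex.Re (f i)) (fun i => nc_Re _).
have h2 := nn (fun i => complex.Im (f i)) (fun i => im _).
rewrite /csum (complexE (_ +i* _)%C) /=.
apply: eq_has_sum (has_sumD h1 (has_sumZ 'i%C h2)) => i.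
by rewrite -complexE.
Qed.

Lemma sum_bound_le f (g : I -> R) c : (forall i, nc (f i) <= g i) ->
  (forall X, \sum_(i <- X) g i <= c) -> sum_bound f c.
Proof. by move=> fg gc X; apply: le_trans (gc X); exact: ler_sum. Qed.

(** Cauchy criterion: beyond [X] the partial sums of moduli stay within [e / 2] of their limit, so a
    set disjoint from [X] adds at most [e]. *)
Lemma sum_bound_tail f c : sum_bound f c -> forall e : R, 0 < e ->
  exists X, forall Y, [disjoint X & Y]%fset -> \sum_(i <- Y) nc (f i) <= e.
Proof.
move=> fc e e0.
have [Sf S] := @has_sum_nonneg (fun i => nc (f i)) c (fun i => nc_ge0 _) fc.
have e2 : 0 < e / 2 by lra.
have [X hX] := S _ e2; exists X => Y XY.
have h1 := hX X (fsubset_refl _).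
have h2 := hX (X `|` Y)%fset (fsubsetUl _ _).
move: h1 h2; rewrite -!rmorph_sum -!rmorphB !ncR.
rewrite (fsumID _ (fsubsetUl X Y)).
rewrite (_ : ((X `|` Y) `\` X)%fset = Y); last first.
  apply/fsetP => i; rewrite in_fsetD in_fsetU.
  case: (boolP (i \in X)) => //= iX.
  by apply/esym/negbTE; exact: (fdisjointP XY).
rewrite !ler_norml => /andP[a1 a2] /andP[b1 b2]; lra.
Qed.

End OneIndex.
End Sums.

Section FiniteSums.
Variables (R : realType).

Lemma fsum_pred1 (V : nmodType) (I : choiceType) (X : {fset I}) (i0 : I) (a : V) :
  \sum_(i <- X) a *+ (i == i0) = a *+ (i0 \in X).
Proof.
case: (boolP (i0 \in X)) => iX.
  by rewrite (bigD1_seq i0)//= eqxx big1 ?addr0// => i /negPf ->.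
rewrite big1_seq// => i /andP[_ iX']; case: eqP => // e.
by rewrite -e iX' in iX.
Qed.

(** The injection into pairs places [Z] inside the product of its two images; the remaining terms of
    that product are nonnegative. *)
Lemma fsum_split_le (I J L : choiceType) (hd : L -> I) (tl : L -> J)
    (F : I -> J -> R) (Z : {fset L}) :
  injective (fun l => (hd l, tl l)) -> (forall x y, 0 <= F x y) ->
  \sum_(l <- Z) F (hd l) (tl l) <=
  \sum_(x <- (hd @` Z)%fset) \sum_(y <- (tl @` Z)%fset) F x y.
Proof.
move=> inj F0.
(* Each term of the rectangle is repeated once for every [l] in [Z] lying over [(x, y)]: at most
   once, by injectivity. *)
apply: (@le_trans _ _ (\sum_(x <- (hd @` Z)%fset) \sum_(y <- (tl @` Z)%fset)
   \sum_(l <- Z) F x y *+ ((hd l == x) && (tl l == y)))); last first.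
  apply: ler_sum => x _; apply: ler_sum => y _.
  have [[l0 _ /eqP e0]|no] := pselect (exists2 l, l \in Z & (hd l, tl l) == (x, y)).
    rewrite (eq_bigr (fun l => F x y *+ (l == l0))); last first.
      move=> l _; congr (_ *+ nat_of_bool _); rewrite -xpair_eqE -e0.
      by apply/eqP/eqP => [/inj|->].
    by rewrite fsum_pred1; case: (_ \in _) => //=; rewrite mulr0n.
  rewrite big1_seq// => l /= lZ; case: (boolP (_ && _)) => // e.
  by exfalso; apply: no; exists l.
rewrite le_eqVlt; apply/orP; left; apply/eqP; symmetry.
under eq_bigr do rewrite exchange_big.
rewrite exchange_big; rewrite big_seq [RHS]big_seq; apply: eq_bigr => l lZ /=.
rewrite (eq_bigr (fun x => F (hd l) (tl l) *+ (x == hd l))); last first.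
  move=> x _; rewrite (eq_bigr (fun y => (F x (tl l) *+ (hd l == x)) *+ (y == tl l))).
    rewrite fsum_pred1 in_imfset// mulr1n eq_sym.
    by case: eqP => [->|].
  move=> y _; rewrite [y == _]eq_sym.
  by case: (hd l == x) => //=; case: eqP => [->|]//; rewrite mul0rn.
by rewrite fsum_pred1 in_imfset.
Qed.

End FiniteSums.

(** * Double sums and rearrangements *)

Section Fubini.
Variable R : realType.
Local Notation C := R[i].
Local Notation nc := (@ComplexField.Normc.normc R).

Lemma has_sum_fsum_le (I : choiceType) (g : I -> R) (s : R) (X : {fset I}) :
  (forall i, 0 <= g i) -> has_sum (fun i => (g i)%:C) s%:C ->
  \sum_(i <- X) g i <= s.
Proof.
move=> g0 gs; apply/ler_addgt0Pr => e e0; have [X0 hX] := gs _ e0.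
have := hX _ (fsubsetUl X0 X); rewrite -rmorph_sum -rmorphB ncR ler_norml.
move=> /andP[_]; have := fsum_subset g0 (fsubsetUr X0 X); lra.
Qed.

Section TwoIndices.
Variables I J : choiceType.

(** Testing on finite rectangles is enough for a double family and keeps pairs out of the index
    types. *)
Definition sum_bound2 (F : I -> J -> C) (c : R) : Prop :=
  forall (X : {fset I}) (Y : {fset J}),
    \sum_(i <- X) \sum_(j <- Y) nc (F i j) <= c.

Lemma sum_bound2_row F c i : sum_bound2 F c -> sum_bound (F i) c.
Proof. by move=> Fc Y; have := Fc [fset i]%fset Y; rewrite big_seq_fset1. Qed.

(** Each row sum is dominated by the sum [r i] of the moduli of its row; a finite sum of the [r i]
    is a limit of sums over rectangles. *)
Lemma sum_bound_rows F G c : sum_bound2 F c ->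
  (forall i, has_sum (F i) (G i)) -> sum_bound G c.
Proof.
move=> Fc FG X.
have N i : exists2 r : R, 0 <= r & has_sum (fun j => (nc (F i j))%:C) r%:C.
  have [_ h] := @has_sum_nonneg _ _ (fun j => nc (F i j)) c
    (fun j => nc_ge0 _) (sum_bound2_row i Fc).
  exists (fine (\esum_(j in [set: J]) (nc (F i j))%:E)) => //.
  by rewrite fine_ge0// esum_ge0// => j _; rewrite lee_fin nc_ge0.
have {N}[r r0 Nr] : exists2 r : I -> R, (forall i, 0 <= r i) &
    forall i, has_sum (fun j => (nc (F i j))%:C) (r i)%:C.
  have [r hr] := choice (fun i => ltac:(have [r r0 hr] := N i;
    exact: (ex_intro (fun r : R => 0 <= r /\ has_sum (fun j => (nc (F i j))%:C) r%:C) r (conj r0 hr)))).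
  by exists r => i; have [] := hr i.
apply: (@le_trans _ _ (\sum_(i <- X) r i)).
  apply: ler_sum => i _; apply: has_sum_le (FG i) => Y.
  by apply: has_sum_fsum_le (Nr i) => j; exact: nc_ge0.
have hs := has_sum_sum X Nr.
have : nc (\sum_(i <- X) (r i)%:C) <= c.
  apply: has_sum_le hs => Y.
  apply: le_trans (Fc X Y); rewrite exchange_big /=; apply: ler_sum => j _.
  rewrite -rmorph_sum ncR ger0_norm// sumr_ge0// => i _; exact: nc_ge0.
by rewrite -rmorph_sum ncR ger0_norm// sumr_ge0.
Qed.

End TwoIndices.

Lemma sum_bound2C (I J : choiceType) (F : I -> J -> C) c :
  sum_bound2 F c -> sum_bound2 (fun j i => F i j) c.
Proof. by move=> Fc X Y; rewrite exchange_big. Qed.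

(** The tail criterion for the column sums of the moduli: [Y0] has to work for all finite [X] at
    once. *)
Lemma sum_bound2_tail (I J : choiceType) (F : I -> J -> C) (c : R) :
  sum_bound2 F c -> forall e : R, 0 < e -> exists Y0 : {fset J},
  forall (X : {fset I}) (Y : {fset J}), [disjoint Y0 & Y]%fset ->
    \sum_(i <- X) \sum_(j <- Y) nc (F i j) <= e.
Proof.
move=> Fc e e0.
pose F' j i : C := (nc (F i j))%:C.
have nF' j i : nc (F' j i) = nc (F i j).
  by rewrite ncR ger0_norm// nc_ge0.
have F'c : sum_bound2 F' c.
  move=> Y X; apply: le_trans (Fc X Y); rewrite exchange_big /=.
  by apply: ler_sum => i _; apply: ler_sum => j _; rewrite nF'.
have F's j := csumP (sum_bound2_row j F'c).
have [Y0 hY] := sum_bound_tail (sum_bound_rows F'c F's) e0.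
exists Y0 => X Y dXY; apply: le_trans (hY Y dXY); rewrite exchange_big /=.
apply: ler_sum => j _.
apply: (@le_trans _ _ (complex.Re (csum (F' j)))); last first.
  exact: (le_trans (ler_norm _) (nc_Re _)).
have [_ h] := @has_sum_nonneg _ _ (fun i => nc (F i j)) c
  (fun i => nc_ge0 _) (sum_bound2_row j (sum_bound2C Fc)).
rewrite -(has_sum_unique h (F's j)) /=.
apply: has_sum_fsum_le h => i; exact: nc_ge0.
Qed.

(** Deleting the columns in a large finite [Y] leaves a family [F'] of total absolute mass at most
    [e]. Its row sums are [G i] minus a finite sum, so they add up to [s] minus the sum of [H] over
    [Y], which is therefore at most [e] in modulus. *)
Lemma fubini (I J : choiceType) (F : I -> J -> C) G H s c : sum_bound2 F c ->
  (forall i, has_sum (F i) (G i)) -> (forall j, has_sum (F^~ j) (H j)) ->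
  has_sum G s -> has_sum H s.
Proof.
move=> Fc FG FH Gs e e0.
have [Y0 hY0] := sum_bound2_tail Fc e0.
exists Y0 => Y Y0Y; rewrite nc_distC.
pose F' i j : C := if j \in Y then 0 else F i j.
have F'e : sum_bound2 F' e.
  move=> X Y'; apply: le_trans (hY0 X (Y' `\` Y)%fset _); last first.
    apply/fdisjointP => j /(fsubsetP Y0Y) jY; by rewrite in_fsetD jY.
  apply: ler_sum => i _; rewrite (bigID (fun j => j \in Y)) /=.
  rewrite big1 ?add0r; last by move=> j jY; rewrite /F' jY nc0.
  rewrite (eq_bigr (fun j => nc (F i j))); last first.
    by move=> j jY; rewrite /F' (negPf jY).
  rewrite -big_filter; rewrite le_eqVlt; apply/orP; left; apply/eqP.
  apply: perm_big; apply: uniq_perm; rewrite ?filter_uniq//.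
  by move=> j; rewrite mem_filter in_fsetD.
have F's i : has_sum (F' i) (G i + -1 * (\sum_(j <- Y) F i j)).
  have h : has_sum (fun j => if j \in Y then F i j else 0) (\sum_(j <- Y) F i j).
    rewrite big_seq (eq_bigr (fun j => if j \in Y then F i j else 0)); last first.
      by move=> j ->.
    rewrite -big_seq; apply: has_sum_fin => j; by case: ifP.
  apply: eq_has_sum (has_sumD (FG i) (has_sumZ (-1) h)) => j.
  by rewrite /F'; case: ifP => _; rewrite mulN1r ?subrr ?subr0.
have := sum_bound_rows F'e F's.
move=> /has_sum_le; apply.
rewrite -[X in _ - X]mul1r -mulNr; apply: has_sumD => //.
by apply: has_sumZ; exact: has_sum_sum.
Qed.

(** Fubini for the matrix that places [f i] in the single column [h i]. *)
Lemma has_sum_partition (I J : choiceType) (h : I -> J) (f : I -> C) H s c :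
  sum_bound f c -> (forall j, has_sum (fun i => f i *+ (h i == j)) (H j)) ->
  has_sum f s -> has_sum H s.
Proof.
move=> fc fH; apply: (@fubini _ _ (fun i j => f i *+ (h i == j)) _ _ _ c) => //.
  move=> X Y; apply: le_trans (fc X); apply: ler_sum => i _.
  rewrite (eq_bigr (fun j => nc (f i) *+ (j == h i))).
    by rewrite fsum_pred1; case: (_ \in _); rewrite ?mulr0n ?nc_ge0.
  by move=> j _; rewrite eq_sym; case: eqP; rewrite ?mulr0n ?nc0.
move=> i; have := @has_sum1 _ _ (fun j => f i *+ (h i == j)) (h i).
rewrite eqxx mulr1n; apply=> j; by rewrite eq_sym => /negPf ->.
Qed.

(** Fubini for the incidence matrix of [h]: each column has one entry, and a row off the image of
    [h] vanishes because [f] does. *)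
Lemma has_sum_reindex (I J : choiceType) (h : J -> I) (f : I -> C) s c :
  sum_bound f c -> injective h -> (forall i, (forall j, h j != i) -> f i = 0) ->
  has_sum f s -> has_sum (f \o h) s.
Proof.
move=> fc hinj f0; apply: (@fubini _ _ (fun i j => f i *+ (h j == i)) _ _ _ c).
- move=> X Y; apply: le_trans (fc X); apply: ler_sum => i _.
  have [[j0 hj0]|no] := pselect (exists j, h j = i).
    rewrite (eq_bigr (fun j => nc (f i) *+ (j == j0))).
      by rewrite fsum_pred1; case: (_ \in _); rewrite ?mulr0n ?nc_ge0.
    move=> j _; rewrite -hj0 (inj_eq hinj).
    by case: eqP => _; rewrite ?mulr0n ?nc0.
  rewrite big1 ?nc_ge0// => j _; rewrite f0 ?mul0rn ?nc0// => k.
  by apply/eqP => hk; apply: no; exists k.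
- move=> i; have [[j0 hj0]|no] := pselect (exists j, h j = i).
    have := @has_sum1 _ _ (fun j => f i *+ (h j == i)) j0.
    rewrite hj0 eqxx mulr1n; apply=> j; rewrite -hj0 (inj_eq hinj).
    by move=> /negPf ->.
  rewrite (f0 i); last by move=> k; apply/eqP => hk; apply: no; exists k.
  by apply: eq_has_sum (@has_sum0 R J) => j; rewrite mul0rn.
- move=> j; have := @has_sum1 _ _ (fun i => f i *+ (h j == i)) (h j).
  rewrite eqxx mulr1n; apply=> i; by rewrite eq_sym => /negPf ->.
Qed.

(** * Sums over an index that splits into a head and a tail *)

Section Split.
Variables (I J L : choiceType) (hd : L -> I) (tl : L -> J) (mk : I -> J -> L).
Hypotheses (hdK : forall x y, hd (mk x y) = x) (tlK : forall x y, tl (mk x y) = y)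
  (mkK : forall l, mk (hd l) (tl l) = l).

Lemma split_inj : injective (fun l => (hd l, tl l)).
Proof. by move=> k l [e1 e2]; rewrite -(mkK k) e1 e2 mkK. Qed.

Lemma sum_bound_split (f : I -> C) (g : J -> C) a b :
  sum_bound f a -> sum_bound g b ->
  sum_bound (fun l => f (hd l) * g (tl l)) (a * b).
Proof.
move=> fa gb X; under eq_bigr do rewrite ncM.
apply: le_trans (fsum_split_le (F := fun x y => nc (f x) * nc (g y)) _ split_inj _) _.
  by move=> x y; rewrite mulr_ge0// nc_ge0.
under eq_bigr do rewrite -big_distrr /=.
rewrite -big_distrl /=; apply: ler_pM => //; apply: sumr_ge0 => *; exact: nc_ge0.
Qed.

(** Partition [L] by [tl]: the fibre over [y] is reindexed by [x |-> mk x y] and contributes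
    [s * g y]. *)
Lemma has_sum_split (f : I -> C) (g : J -> C) a b s t :
  sum_bound f a -> sum_bound g b -> has_sum f s -> has_sum g t ->
  has_sum (fun l => f (hd l) * g (tl l)) (s * t).
Proof.
move=> fa gb fs gt.
have fg := sum_bound_split fa gb; have fgs := csumP fg.
suff -> : s * t = csum (fun l => f (hd l) * g (tl l)) by [].
apply: has_sum_unique (has_sumZ s gt) _.
apply: (has_sum_partition fg _ fgs) => y.
have hs : has_sum (fun x => f x * g y) (s * g y).
  by rewrite mulrC; apply: eq_has_sum (has_sumZ (g y) fs) => x; rewrite mulrC.
pose F l := f (hd l) * g (tl l) *+ (tl l == y); rewrite -/F.
have Fb : sum_bound F (a * b).
  move=> X; apply: le_trans (fg X); apply: ler_sum => l _; rewrite /F.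
  by case: eqP; rewrite ?mulr0n ?nc0 ?nc_ge0.
have mkinj : injective (fun x => mk x y).
  by move=> x x' /(congr1 hd); rewrite !hdK.
have := has_sum_reindex Fb mkinj _ (csumP Fb).
have -> : F \o (fun x => mk x y) = fun x => f x * g y.
  by apply/funext => x; rewrite /F /= hdK tlK eqxx.
move=> h; rewrite (has_sum_unique hs (h _)); first exact: csumP Fb.
move=> l hl; rewrite /F; case: eqP => // e.
by have := hl (hd l); rewrite -e mkK eqxx.
Qed.

End Split.
End Fubini.

Lemma has_sum_series (R : realType) (f : nat -> R[i]) (s : R[i]) :
  has_sum f s -> series (f : nat -> R[i]^o) @ \oo --> (s : R[i]^o).
Proof.
move=> fs; apply/cvgrPdist_le => e e0.
(* In the partial order of [R[i]], [0 < e] makes [e] a positive real, so its real part carries the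
   whole estimate. *)
have e0' : 0 < complex.Re e by move: e0; rewrite ltcE => /andP[].
have [X hX] := fs _ e0'.
pose N := \max_(i <- X) i.+1.
exists N => // n /= Nn.
have := hX [fset k in iota 0 n]%fset _.
have -> : \sum_(i <- [fset k in iota 0 n]%fset) f i = series (f : nat -> R[i]^o) n.
  rewrite /series /=; apply: perm_big; apply: uniq_perm.
  - exact: fset_uniq.
  - exact: iota_uniq.
  - by move=> i; rewrite inE /= /index_iota subn0.
move=> h; have {}h : ComplexField.Normc.normc (series (f : nat -> R[i]^o) n - s) <= complex.Re e.
  apply: h; apply/fsubsetP => i iX; rewrite inE /= mem_iota /= add0n.
  by apply: leq_trans Nn; rewrite /N; apply: (@leq_bigmax_seq _ _ predT succn).
rewrite distrC; change ((ComplexField.Normc.normc (series (f : nat -> R[i]^o) n - s))%:C <= e).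
rewrite lecE /= h andbT; move: e0; rewrite ltcE => /andP[/eqP -> _] //.
Qed.

(** * Square-summable vectors and bounded operators *)

Section Ell2.
Variables (R : realType) (I : choiceType).
Local Notation C := R[i].
Local Notation nc := (@ComplexField.Normc.normc R).
Local Notation H := (ell2 R I).
Implicit Types (u v w : H) (f : I -> C) (i j k : I).

Definition sq_bound (f : I -> C) (c : R) : Prop :=
  forall X : {fset I}, \sum_(i <- X) nc (f i) ^+ 2 <= c.

Lemma sq_bound_summable f c : sq_bound f c -> f \in @square_summable R I.
Proof.
move=> fc; rewrite inE /= /sqsum.
have [h _] := @has_sum_nonneg R I (fun i => nc (f i) ^+ 2) c
  (fun i => sqr_ge0 _) fc.
by rewrite ltey_eq h.
Qed.

Lemma sq_bound_hnorm u : sq_bound u (hnorm u ^+ 2).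
Proof.
have h : (sqsum u < +oo)%E by have := valP u; rewrite inE.
have s0 : (0 <= sqsum u)%E by apply: esum_ge0 => i _; rewrite lee_fin sqr_ge0.
move=> X; rewrite /hnorm sqr_sqrtr ?fine_ge0//.
rewrite -lee_fin fineK ?ge0_fin_numE//.
apply: ereal_sup_ubound; exists [set` X]; first by split.
by rewrite fsbig_finite//= set_fsetK sumEFin.
Qed.

Lemma hnorm_ge0 u : 0 <= hnorm u.
Proof. exact: sqrtr_ge0. Qed.

Lemma hnorm_sq_has_sum u :
  has_sum (fun i => (nc (u i) ^+ 2)%:C) (hnorm u ^+ 2)%:C.
Proof.
have [h1 h2] := @has_sum_nonneg R I (fun i => nc (u i) ^+ 2) _
  (fun i => sqr_ge0 _) (@sq_bound_hnorm u).
rewrite /hnorm sqr_sqrtr// fine_ge0// esum_ge0// => i _.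
by rewrite lee_fin sqr_ge0.
Qed.

Lemma hnorm_sq_le u c : sq_bound u c -> hnorm u ^+ 2 <= c.
Proof.
move=> uc; have : nc (hnorm u ^+ 2)%:C <= c.
  apply: has_sum_le (hnorm_sq_has_sum u) => X.
  apply: le_trans (uc X); apply: ler_sum => i _.
  by rewrite ncR ger0_norm// sqr_ge0.
by rewrite ncR ger0_norm// sqr_ge0.
Qed.

Lemma hnorm_le u (c : R) : 0 <= c -> sq_bound u (c ^+ 2) -> hnorm u <= c.
Proof. by move=> c0 /hnorm_sq_le; rewrite ler_sqr ?nnegrE ?hnorm_ge0. Qed.

Lemma nc_le_hnorm u i : nc (u i) <= hnorm u.
Proof.
have := @sq_bound_hnorm u [fset i]%fset; rewrite big_seq_fset1.
by rewrite ler_sqr ?nnegrE ?hnorm_ge0 ?nc_ge0.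
Qed.

Lemma ell2P u v : u =1 v -> u = v.
Proof. by move=> uv; apply: val_inj; apply/funext. Qed.

(* The zero vector when [f] is not square-summable. *)
Definition to_ell2 f : H := insubd (0 : H) f.

Lemma to_ell2E f c : sq_bound f c -> to_ell2 f = f :> (I -> C).
Proof. by move=> /sq_bound_summable h; rewrite -[LHS]/(val _) val_insubd h. Qed.

Lemma ell2_lin (a : C) u v i : (a *: u + v) i = a * u i + v i.
Proof. by []. Qed.
Lemma ell2D u v i : (u + v) i = u i + v i. Proof. by []. Qed.
Lemma ell2N u i : (- u) i = - u i. Proof. by []. Qed.
Lemma ell2Z (a : C) u i : (a *: u) i = a * u i. Proof. by []. Qed.
Lemma ell2_0 i : (0 : H) i = 0. Proof. by []. Qed.
Lemma ell2_sum (J : Type) (r : seq J) (F : J -> H) i :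
  (\sum_(j <- r) F j) i = \sum_(j <- r) F j i.
Proof. by elim/big_ind2: _ => // a b x y; rewrite ell2D => -> ->. Qed.

Lemma ketE i j : ket R i j = (j == i)%:R. Proof. by []. Qed.

Lemma cauchy_schwarz_bound u v :
  sum_bound (fun i => (u i)^*%C * v i) (hnorm u * hnorm v).
Proof.
move=> X; under eq_bigr do rewrite ncM ncJ.
have := @sq_bound_hnorm u X; have := @sq_bound_hnorm v X.
move: (hnorm_ge0 u) (hnorm_ge0 v) (nc_le_hnorm u) (nc_le_hnorm v).
move: (hnorm u) (hnorm v) => p q p0 q0 up vq vs us.
have [p00|p00] := eqVneq p 0.
  rewrite p00 mul0r big1// => i _.
  have -> : nc (u i) = 0 by apply/eqP; rewrite eq_le nc_ge0 -p00 up.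
  by rewrite mul0r.
have [q00|q00] := eqVneq q 0.
  rewrite q00 mulr0 big1// => i _.
  have -> : nc (v i) = 0 by apply/eqP; rewrite eq_le nc_ge0 -q00 vq.
  by rewrite mulr0.
have {p00}p0 : 0 < p by rewrite lt_def p00.
have {q00}q0 : 0 < q by rewrite lt_def q00.
(* AM-GM: [a b <= (q a^2 / p + p b^2 / q) / 2] *)
apply: (@le_trans _ _ (\sum_(i <- X) (q / p / 2 * nc (u i) ^+ 2 + p / q / 2 * nc (v i) ^+ 2))).
  apply: ler_sum => i _; rewrite -subr_ge0.
  have -> : q / p / 2 * nc (u i) ^+ 2 + p / q / 2 * nc (v i) ^+ 2
    - nc (u i) * nc (v i) =
    (q * nc (u i) - p * nc (v i)) ^+ 2 / (2 * p * q).
    by field; rewrite !gt_eqF.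
  by rewrite divr_ge0 ?sqr_ge0// !mulr_ge0// ltW.
rewrite big_split /= -!big_distrr /=.
have -> : p * q = q / p / 2 * p ^+ 2 + p / q / 2 * q ^+ 2.
  by field; rewrite !gt_eqF.
by apply: lerD; apply: ler_wpM2l => //; rewrite !divr_ge0// ltW.
Qed.

Lemma inner_has_sum u v : has_sum (fun i => (u i)^*%C * v i) (inner u v).
Proof. exact: csumP (@cauchy_schwarz_bound u v). Qed.

Lemma inner_le u v : nc (inner u v) <= hnorm u * hnorm v.
Proof. exact: has_sum_le (@cauchy_schwarz_bound u v) (inner_has_sum u v). Qed.

Lemma inner_lin u (a : C) v w : inner u (a *: v + w) = a * inner u v + inner u w.
Proof.
apply: has_sum_unique (inner_has_sum _ _) _.
apply: eq_has_sum (has_sumD (has_sumZ a (inner_has_sum u v)) (inner_has_sum u w)).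
by move=> i; rewrite ell2_lin; ring.
Qed.

Lemma innerC u v : inner v u = (inner u v)^*%C.
Proof.
apply: has_sum_unique (inner_has_sum _ _) _.
apply: eq_has_sum (has_sumJ (inner_has_sum u v)).
by move=> i; rewrite conjcM conjcK mulrC.
Qed.

Lemma innerr0 u : inner u 0 = 0.
Proof.
apply: has_sum_unique (inner_has_sum _ _) _.
by apply: eq_has_sum (@has_sum0 R I) => i; rewrite ell2_0 mulr0.
Qed.

Lemma innerDr u v w : inner u (v + w) = inner u v + inner u w.
Proof. by have := inner_lin u 1 v w; rewrite scale1r mul1r. Qed.
Lemma innerZr u a v : inner u (a *: v) = a * inner u v.
Proof. by have := inner_lin u a v 0; rewrite addr0 innerr0 addr0. Qed.
Lemma innerDl u v w : inner (u + v) w = inner u w + inner v w.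
Proof. by rewrite innerC innerDr conjcD -!innerC. Qed.
Lemma innerZl u a v : inner (a *: u) v = a^*%C * inner u v.
Proof. by rewrite innerC innerZr conjcM -innerC. Qed.
Lemma inner0l u : inner 0 u = 0.
Proof. by rewrite innerC innerr0 conjc0. Qed.

Lemma inner_sumr (J : Type) (r : seq J) (F : J -> H) u :
  inner u (\sum_(j <- r) F j) = \sum_(j <- r) inner u (F j).
Proof.
by elim: r => [|j r IH]; rewrite ?big_nil ?innerr0// !big_cons innerDr IH.
Qed.
Lemma inner_suml (J : Type) (r : seq J) (F : J -> H) u :
  inner (\sum_(j <- r) F j) u = \sum_(j <- r) inner (F j) u.
Proof.
by elim: r => [|j r IH]; rewrite ?big_nil ?inner0l// !big_cons innerDl IH.
Qed.

Lemma inner_ketl i u : inner (ket R i) u = u i.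
Proof.
apply: has_sum_unique (inner_has_sum _ _) _.
have := @has_sum1 R I (fun j => (ket R i j)^*%C * u j) i.
rewrite ketE eqxx conjc1 mul1r; apply=> j /negPf ji.
by rewrite ketE ji conjc0 mul0r.
Qed.

Lemma inner_ketr i u : inner u (ket R i) = (u i)^*%C.
Proof. by rewrite innerC inner_ketl. Qed.

Lemma inner_self u : inner u u = (hnorm u ^+ 2)%:C.
Proof.
apply: has_sum_unique (inner_has_sum _ _) _.
by apply: eq_has_sum (hnorm_sq_has_sum u) => i; rewrite conjcM_nc.
Qed.

Lemma inner_ext u v : (forall w, inner u w = inner v w) -> u = v.
Proof.
move=> uv; apply: ell2P => i; apply: (can_inj (@conjcK R)).
by rewrite -!inner_ketr uv.
Qed.

Definition bounded_form (phi : H -> C) : Prop :=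
  (forall a u v, phi (a *: u + v) = a * phi u + phi v) /\
  exists c : R, forall u, nc (phi u) <= c * hnorm u.

(** Density of the finite combinations of kets: the truncation [p] of [u] to a finite set is killed
    by [phi], and the norm of [u - p] is a tail of the square sum. *)
Lemma bounded_form0 phi : bounded_form phi ->
  (forall i, phi (ket R i) = 0) -> forall u, phi u = 0.
Proof.
move=> [lin [c hc]] ph0 u; apply: nc_eq0_le => e e0.
(* The constant [c] of a bounded form may be zero or negative; this majorant can be divided by. *)
have c1 : 0 < `|c| + 1 by rewrite ltr_wpDl.
pose f i : C := (nc (u i) ^+ 2)%:C.
have fb : sum_bound f (hnorm u ^+ 2).
  move=> X; apply: le_trans (@sq_bound_hnorm u X); apply: ler_sum => i _.
  by rewrite ncR ger0_norm// sqr_ge0.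
have ed : 0 < e / (`|c| + 1) by exact: divr_gt0.
have [X hX] := sum_bound_tail fb (exprn_gt0 2 ed).
pose p := \sum_(i <- X) u i *: ket R i.
have phi0 : phi 0 = 0.
  have := lin 1 0 0; rewrite scaler0 addr0 mul1r => /eqP.
  by rewrite -subr_eq0 opprD addrA subrr add0r oppr_eq0 => /eqP.
have phip : phi p = 0.
  rewrite /p; elim: {p hX}(enum_fset X) => [|i r IH]; rewrite ?big_nil//.
  by rewrite big_cons lin IH ph0 mulr0 addr0.
have -> : phi u = phi (u - p).
  have := lin (-1) p u; rewrite scaleN1r phip mulr0 add0r => <-.
  by rewrite addrC.
apply: (le_trans (hc _)).
apply: (@le_trans _ _ ((`|c| + 1) * hnorm (u - p))).
  apply: ler_wpM2r; first exact: hnorm_ge0.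
  by apply: (le_trans (ler_norm c)); rewrite lerDl.
rewrite mulrC -ler_pdivlMr//; apply: hnorm_le; first exact: ltW.
have pE i : p i = if i \in X then u i else 0.
  rewrite /p ell2_sum (eq_bigr (fun j => u i *+ (j == i))).
    by rewrite fsum_pred1; case: (i \in X).
  move=> j _; rewrite ell2Z ketE eq_sym.
  by case: eqP => [->|]; rewrite ?mulr1 ?mulr0.
move=> Y; apply: le_trans (hX (Y `\` X)%fset _); last first.
  by apply/fdisjointP => i iX; rewrite in_fsetD iX.
have E i : nc ((u - p) i) ^+ 2 = if i \in X then 0 else nc (f i).
  rewrite ell2D ell2N pE; case: ifP => _; first by rewrite subrr nc0 expr0n.
  by rewrite subr0 ncR ger0_norm// sqr_ge0.
rewrite (eq_bigr _ (fun i _ => E i)) (bigID (fun i => i \in X)) /=.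
rewrite big1 ?add0r; last by move=> i ->.
rewrite (eq_bigr (fun i => nc (f i))); last by move=> i /negPf ->.
rewrite -big_filter le_eqVlt; apply/orP; left; apply/eqP.
apply: perm_big; apply: uniq_perm; rewrite ?filter_uniq//.
by move=> j; rewrite mem_filter in_fsetD.
Qed.

(** * Bounded operators, adjoints and traces *)

Section BoundedOps.
Implicit Types A B : op R I.

Lemma bounded_opE A : bounded_op A -> exists2 c : R, 0 <= c &
  forall u, hnorm (A u) <= c * hnorm u.
Proof.
move=> [_ [c hc]]; exists `|c| => // u; apply: (le_trans (hc u)).
by apply: ler_wpM2r; rewrite ?hnorm_ge0// ler_norm.
Qed.

Lemma op_lin A a u v : bounded_op A -> A (a *: u + v) = a *: A u + A v.
Proof. by case. Qed.
Lemma op0 A : bounded_op A -> A 0 = 0.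
Proof.
move=> bA; have /eqP := op_lin 1 0 0 bA; rewrite !scale1r addr0.
by rewrite -subr_eq0 opprD addrA subrr add0r oppr_eq0 => /eqP.
Qed.
Lemma opD A u v : bounded_op A -> A (u + v) = A u + A v.
Proof. by move=> bA; have := op_lin 1 u v bA; rewrite !scale1r. Qed.
Lemma opZ A a u : bounded_op A -> A (a *: u) = a *: A u.
Proof. by move=> bA; have := op_lin a u 0 bA; rewrite !addr0 (op0 bA) addr0. Qed.
Lemma op_sum A (J : Type) (r : seq J) (F : J -> H) : bounded_op A ->
  A (\sum_(j <- r) F j) = \sum_(j <- r) A (F j).
Proof.
by move=> bA; elim: r => [|j r IH]; rewrite ?big_nil ?op0// !big_cons opD// IH.
Qed.

Lemma bounded_id : bounded_op (id : op R I).
Proof. by split=> //; exists 1 => u; rewrite mul1r. Qed.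

Lemma bounded_comp A B : bounded_op A -> bounded_op B -> bounded_op (A \o B).
Proof.
move=> bA bB; split; first by move=> a u v /=; rewrite !op_lin.
have [a a0 ha] := bounded_opE bA; have [b b0 hb] := bounded_opE bB.
exists (a * b) => u /=; apply: (le_trans (ha _)).
by rewrite -mulrA ler_wpM2l.
Qed.

Lemma bounded_form_inner A u : bounded_op A ->
  bounded_form (fun v => inner u (A v)).
Proof.
move=> bA; split=> [a v w|]; first by rewrite op_lin// inner_lin.
have [c c0 hc] := bounded_opE bA; exists (hnorm u * c) => v.
by apply: (le_trans (inner_le _ _)); rewrite -mulrA ler_wpM2l ?hnorm_ge0.
Qed.

Lemma bounded_form_sub phi psi : bounded_form phi -> bounded_form psi ->
  bounded_form (fun u => phi u - psi u).
Proof.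
move=> [l1 [c1 h1]] [l2 [c2 h2]]; split=> [a u v|].
  by rewrite l1 l2; ring.
exists (c1 + c2) => u; apply: (le_trans (ncD _ _)).
by rewrite ncN mulrDl lerD.
Qed.

Lemma bounded_form_ext phi psi : bounded_form phi -> bounded_form psi ->
  (forall i, phi (ket R i) = psi (ket R i)) -> phi =1 psi.
Proof.
move=> b1 b2 h u; apply/eqP; rewrite -subr_eq0; apply/eqP.
apply: (bounded_form0 (bounded_form_sub b1 b2)) => i.
by rewrite h subrr.
Qed.

Lemma op_ext A B : bounded_op A -> bounded_op B ->
  (forall i j, inner (ket R i) (A (ket R j)) = inner (ket R i) (B (ket R j))) ->
  A = B.
Proof.
move=> bA bB AB; apply/funext => u; apply: ell2P => i.
rewrite -!inner_ketl.
exact: (bounded_form_ext (bounded_form_inner _ bA) (bounded_form_inner _ bB)).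
Qed.

(** [op_of_mx] is a choice with a default, so it is usable only through a bounded operator that is
    known to have the given matrix. Most operators below are identified in this way. *)
Lemma op_of_mxE A (m : I -> I -> C) : bounded_op A ->
  (forall i j, inner (ket R i) (A (ket R j)) = m i j) -> op_of_mx m = A.
Proof.
move=> bA mA; rewrite /op_of_mx; case: xgetP => [B _ [bB mB]|/(_ A)].
  by apply: op_ext => // i j; rewrite mA mB.
by case.
Qed.

(** The analysis operator of a family of vectors, adjoint to the map sending the ket of [j] to
    [d j]. It has an explicit formula in coordinates, so it is built first and the map itself is
    recovered as its adjoint. *)
Definition analysis (d : I -> H) : op R I :=
  fun v => to_ell2 (fun j => inner (d j) v).

(** The Bessel bound, stated on finite combinations so that no convergence is presupposed. *)
Definition frame_bound (d : I -> H) (K : R) : Prop :=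
  0 <= K /\ forall (X : {fset I}) (c : I -> C),
    hnorm (\sum_(j <- X) c j *: d j) ^+ 2 <= K ^+ 2 * \sum_(j <- X) nc (c j) ^+ 2.

(* Bessel's inequality: pair [v] with [\sum_j <d_j, v> d_j]. *)
Lemma analysis_sq_bound d K v : frame_bound d K ->
  sq_bound (fun j => inner (d j) v) ((K * hnorm v) ^+ 2).
Proof.
move=> [K0 dK] X; set S := \sum_(_ <- _) _.
have S0 : 0 <= S by apply: sumr_ge0 => *; exact: sqr_ge0.
pose w := \sum_(j <- X) inner (d j) v *: d j.
have wv : inner w v = S%:C.
  rewrite inner_suml rmorph_sum; apply: eq_bigr => j _.
  by rewrite innerZl conjcM_nc.
have := inner_le w v; rewrite wv ncR ger0_norm// => h.
have {}h : S ^+ 2 <= hnorm w ^+ 2 * hnorm v ^+ 2.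
  by rewrite -exprMn ler_sqr ?nnegrE// mulr_ge0// hnorm_ge0.
have {}h : S * S <= (K * hnorm v) ^+ 2 * S.
  rewrite -expr2; apply: (le_trans h); rewrite exprMn [leRHS]mulrAC.
  by apply: ler_wpM2r; [exact: sqr_ge0|exact: dK].
have [->|Sn0] := eqVneq S 0; first exact: sqr_ge0.
by rewrite ler_pM2r// lt_def Sn0 in h.
Qed.

Lemma analysisE d K v j : frame_bound d K -> analysis d v j = inner (d j) v.
Proof. by move=> dK; rewrite /analysis (to_ell2E (analysis_sq_bound v dK)). Qed.

Lemma analysis_bounded d K : frame_bound d K -> bounded_op (analysis d).
Proof.
move=> dK; have [K0 _] := dK; split=> [a u v|].
  by apply: ell2P => j; rewrite ell2_lin !(analysisE _ _ dK) inner_lin.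
exists K => u; apply: hnorm_le; first by rewrite mulr_ge0// hnorm_ge0.
move=> X; apply: le_trans (analysis_sq_bound u dK X).
by apply: ler_sum => j _; rewrite (analysisE _ _ dK).
Qed.

Definition orthonormal_family (d : I -> H) : Prop :=
  forall i j, inner (d i) (d j) = (i == j)%:R.

Lemma orthonormal_ket : orthonormal_family (@ket R I).
Proof. by move=> i j; rewrite inner_ketl ketE. Qed.

Lemma orthonormal_hnorm d (X : {fset I}) (c : I -> C) : orthonormal_family d ->
  hnorm (\sum_(j <- X) c j *: d j) ^+ 2 = \sum_(j <- X) nc (c j) ^+ 2.
Proof.
move=> od; apply: (@complexI R); rewrite -inner_self inner_suml rmorph_sum.
rewrite big_seq [RHS]big_seq; apply: eq_bigr => i iX.
rewrite innerZl inner_sumr; transitivity (conjc (c i) * c i); last first.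
  exact: conjcM_nc.
congr (_ * _).
rewrite (eq_bigr (fun j => c i *+ (j == i))); last first.
  move=> j _; rewrite innerZr od eq_sym.
  by case: eqP => [->|]; rewrite ?mulr1 ?mulr0.
by rewrite fsum_pred1 iX.
Qed.

Lemma orthonormal_frame d : orthonormal_family d -> frame_bound d 1.
Proof.
by move=> od; split=> // X c; rewrite orthonormal_hnorm// expr1n mul1r.
Qed.

Lemma bounded_frame A : bounded_op A ->
  exists K, frame_bound (fun j => A (ket R j)) K.
Proof.
move=> bA; have [K K0 hK] := bounded_opE bA; exists K; split=> // X c.
rewrite -(orthonormal_hnorm X c orthonormal_ket) -exprMn.
rewrite ler_sqr ?nnegrE ?mulr_ge0 ?hnorm_ge0//.
apply: le_trans (hK _); rewrite op_sum//.
by under [in leRHS]eq_bigr do rewrite opZ//.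
Qed.

Lemma adj_unique A B : (forall u v, inner (B u) v = inner u (A v)) -> adj A = B.
Proof.
move=> AB; rewrite /adj; case: xgetP => [B' _ h|/(_ B) []//].
by apply/funext => u; apply: inner_ext => v; rewrite h AB.
Qed.

(** The columns of [A] satisfy a Bessel bound, and their analysis operator is an adjoint of [A]: the
    two forms agree on kets, hence everywhere. *)
Lemma adj_bounded_inner A : bounded_op A ->
  bounded_op (adj A) /\ forall u v, inner (adj A u) v = inner u (A v).
Proof.
move=> bA; have [K hK] := bounded_frame bA.
pose B := analysis (fun j => A (ket R j)).
have bB : bounded_op B := analysis_bounded hK.
have h u v : inner (B u) v = inner u (A v).
  apply: bounded_form_ext (bounded_form_inner _ bounded_id) (bounded_form_inner _ bA) _ v.
  by move=> j; rewrite inner_ketr (analysisE _ _ hK) -innerC.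
by rewrite (adj_unique h).
Qed.

Lemma bounded_adj A : bounded_op A -> bounded_op (adj A).
Proof. by case/adj_bounded_inner. Qed.
Lemma inner_adjl A u v : bounded_op A -> inner (adj A u) v = inner u (A v).
Proof. by case/adj_bounded_inner. Qed.
Lemma inner_adjr A u v : bounded_op A -> inner u (adj A v) = inner (A u) v.
Proof. by move=> bA; rewrite innerC inner_adjl// -innerC. Qed.

Lemma adj_comp A B : bounded_op A -> bounded_op B ->
  adj (A \o B) = adj B \o adj A.
Proof.
by move=> bA bB; apply: adj_unique => u v /=; rewrite !inner_adjl.
Qed.

Lemma adjK A : bounded_op A -> adj (adj A) = A.
Proof. by move=> bA; apply: adj_unique => u v; rewrite inner_adjr. Qed.

(** The source of all isometries below: a matrix with orthonormal columns comes from a bounded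
    operator. *)
Lemma synthesis d : orthonormal_family d -> exists V : op R I,
  [/\ bounded_op V, forall j, V (ket R j) = d j & adj V \o V = id].
Proof.
move=> od; have fd := orthonormal_frame od.
have bB := analysis_bounded fd; exists (adj (analysis d)).
have bV := bounded_adj bB.
have Vk j : adj (analysis d) (ket R j) = d j.
  apply: inner_ext => v.
  by rewrite inner_adjl// inner_ketl (analysisE _ _ fd).
split=> //; apply: op_ext; [exact: (bounded_comp (bounded_adj bV) bV)|exact: bounded_id|].
by move=> i j /=; rewrite inner_adjr// !Vk od orthonormal_ket.
Qed.

Definition diag (q : I -> R) : op R I :=
  fun u => to_ell2 (fun i => (q i)%:C * u i).

Lemma diag_sq_bound q (K : R) u : (forall i, `|q i| <= K) ->
  sq_bound (fun i => (q i)%:C * u i) ((K * hnorm u) ^+ 2).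
Proof.
move=> qK X; rewrite exprMn.
apply: (@le_trans _ _ (K ^+ 2 * \sum_(i <- X) nc (u i) ^+ 2)); last first.
  by rewrite ler_wpM2l ?sqr_ge0// sq_bound_hnorm.
rewrite big_distrr /=; apply: ler_sum => i _; rewrite ncM exprMn ncR.
apply: ler_wpM2r; first exact: sqr_ge0.
by rewrite ler_sqr ?nnegrE//; apply: le_trans (qK i).
Qed.

Lemma diagE q (K : R) u i : (forall i, `|q i| <= K) -> diag q u i = (q i)%:C * u i.
Proof. by move=> qK; rewrite /diag (to_ell2E (diag_sq_bound u qK)). Qed.

Lemma diag_bounded q (K : R) : (forall i, `|q i| <= K) -> bounded_op (diag q).
Proof.
move=> qK; split=> [a u v|].
  by apply: ell2P => j; rewrite ell2_lin !(diagE _ _ qK) ell2_lin; ring.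
exists `|K| => u; apply: hnorm_le; first by rewrite mulr_ge0// hnorm_ge0.
have qK' i : `|q i| <= `|K| by rewrite (le_trans (qK i))// ler_norm.
move=> X; apply: le_trans (diag_sq_bound u qK' X).
by apply: ler_sum => j _; rewrite (diagE _ _ qK).
Qed.

Lemma diag_ket q (K : R) i : (forall i, `|q i| <= K) ->
  diag q (ket R i) = (q i)%:C *: ket R i.
Proof.
move=> qK; apply: ell2P => j; rewrite (diagE _ _ qK) ell2Z ketE.
by case: eqP => [->|]//; rewrite !mulr0.
Qed.

Lemma op_of_mx_diag q (K : R) (m : I -> I -> C) : (forall i, `|q i| <= K) ->
  (forall i j, m i j = (i == j)%:R * (q i)%:C) -> op_of_mx m = diag q.
Proof.
move=> qK mq; apply: op_of_mxE; first exact: diag_bounded qK.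
move=> i j; rewrite mq (diag_ket _ qK) innerZr inner_ketl ketE mulrC.
by case: eqP => [->|]//; rewrite !mul0r.
Qed.

(** The trace against a mixture of the vectors [V (ket R k)] with weights [p k] is the mixture of
    the expectations of [M]. Summability of [p] and Cauchy-Schwarz give the absolute bound for the
    interchange. *)
Lemma trace_mixture V M (p : I -> R) (c : R) : bounded_op V -> bounded_op M ->
  (forall i, 0 <= p i) -> (forall X : {fset I}, \sum_(i <- X) p i <= c) ->
  has_sum (fun k => (p k)%:C * inner (V (ket R k)) (M (V (ket R k))))
    (trace (V \o diag p \o adj V \o M)).
Proof.
move=> bV bM p0 pc.
have pK i : `|p i| <= c.
  by have := pc [fset i]%fset; rewrite big_seq_fset1 ger0_norm.
have [a a0 ha] := bounded_opE bV.
have [b b0 hb] := bounded_opE (bounded_comp (bounded_adj bM) bV).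
(* Summing over [k] gives the [j]-th diagonal entry of the operator; summing over [j] gives the
   [k]-th weighted expectation. *)
pose F j k := (p k)%:C * ((adj M (V (ket R k)) j)^*%C * V (ket R k) j).
have Fb : sum_bound2 F (c * (b * a)).
  apply: sum_bound2C => X Y.
  apply: (@le_trans _ _ (\sum_(k <- X) p k * (b * a))); last first.
    by rewrite -big_distrl /= ler_wpM2r// mulr_ge0.
  apply: ler_sum => k _; under eq_bigr do rewrite ncM ncR (ger0_norm (p0 k)).
  rewrite -big_distrr /= ler_wpM2l//.
  apply: (le_trans (@cauchy_schwarz_bound _ _ Y)).
  have k1 : hnorm (ket R k) <= 1.
    rewrite -(ler_sqr (hnorm_ge0 _) ler01); apply: hnorm_sq_le => Z.
    rewrite (eq_bigr (fun i => 1 *+ (i == k))).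
      by rewrite fsum_pred1 expr1n; case: (_ \in _).
    by move=> i _; rewrite ketE; case: eqP; rewrite /= ?nc1 ?nc0 ?expr1n ?expr0n.
  apply: ler_pM; rewrite ?hnorm_ge0//.
    by apply: (le_trans (hb _)); rewrite -[leRHS]mulr1 ler_wpM2l.
  by apply: (le_trans (ha _)); rewrite -[leRHS]mulr1 ler_wpM2l.
have rowE j : has_sum (F j)
    (inner (ket R j) ((V \o diag p \o adj V \o M) (ket R j))).
  rewrite /= -inner_adjl//.
  apply: eq_has_sum (inner_has_sum _ _) => k.
  have -> : adj V (ket R j) k = conjc (V (ket R k) j).
    by rewrite -[LHS]inner_ketl inner_adjr// inner_ketr.
  have e : adj V (M (ket R j)) k = conjc (adj M (V (ket R k)) j).
    by rewrite -[LHS]inner_ketl inner_adjr// -inner_adjl// inner_ketr.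
  by rewrite (diagE _ _ pK) e conjcK /F; ring.
apply: (fubini Fb rowE); last first.
  exact: (csumP (sum_bound_rows Fb rowE)).
move=> k; apply: has_sumZ.
have := inner_has_sum (adj M (V (ket R k))) (V (ket R k)).
by rewrite inner_adjl.
Qed.

End BoundedOps.
End Ell2.

(** * Displacement operators *)

Section NatSums.
Variable R : realType.
Local Notation C := R[i].
Local Notation nc := (@ComplexField.Normc.normc R).

Lemma mem_fset_iota N i : (i \in [fset k in iota 0 N]%fset) = (i < N)%N.
Proof. by rewrite inE /= mem_iota /= add0n. Qed.

Lemma fset_nat_sub (X : {fset nat}) :
  exists N, (X `<=` [fset k in iota 0 N])%fset.
Proof.
exists (\max_(i <- X) i.+1); apply/fsubsetP => i iX.
rewrite mem_fset_iota.
by apply: (@leq_bigmax_seq _ _ predT succn).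
Qed.

Lemma big_fset_iota (V : nmodType) (f : nat -> V) N :
  \sum_(i <- [fset k in iota 0 N]%fset) f i = \sum_(i < N) f i.
Proof.
rewrite -(big_mkord predT); apply: perm_big; apply: uniq_perm.
- exact: fset_uniq.
- exact: iota_uniq.
- by move=> i; rewrite inE /= /index_iota subn0.
Qed.

Lemma fsum_nat_le (g : nat -> R) c (X : {fset nat}) : (forall i, 0 <= g i) ->
  (forall N, \sum_(i < N) g i <= c) -> \sum_(i <- X) g i <= c.
Proof.
move=> g0 gc; have [N XN] := fset_nat_sub X.
by apply: (le_trans (fsum_subset g0 XN)); rewrite big_fset_iota.
Qed.

Lemma has_sum_nat_fin (f : nat -> C) N : (forall i, (N <= i)%N -> f i = 0) ->
  has_sum f (\sum_(i < N) f i).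
Proof.
move=> f0; rewrite -(big_fset_iota f); apply: has_sum_fin => i.
by rewrite mem_fset_iota -leqNgt => /f0.
Qed.

Lemma ratio_sum_bound (b : nat -> R) M : (forall m, 0 <= b m) ->
  (forall m, (M <= m)%N -> b m.+1 <= b m / 2) ->
  exists2 c : R, 0 <= c & forall N, \sum_(m < N) b m <= c.
Proof.
(* From index [M] on, the terms are below a geometric series of ratio 1/2, whose sum is [2 * b M];
   the partial sum plus twice the next term does not increase. *)
move=> b0 hb; pose c := \sum_(m < M) b m + 2 * b M; exists c.
  by rewrite addr_ge0 ?sumr_ge0 ?mulr_ge0.
have h n : \sum_(m < M + n) b m + 2 * b (M + n)%N <= c.
  elim: n => [|n IH]; first by rewrite addn0.
  rewrite addnS big_ord_recr /=; have := hb (M + n)%N (leq_addr _ _); lra.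
move=> N; have [NM|/ltnW/subnKC <-] := leqP N M.
  rewrite -(big_mkord predT) /c -(big_mkord predT b) (big_cat_nat _ NM)//=.
  have h1 : 0 <= \sum_(N <= i < M) b i by apply: sumr_ge0.
  have := b0 M; lra.
by apply: le_trans (h (N - M)%N); rewrite lerDl mulr_ge0.
Qed.

End NatSums.

(** The l^1 norm dominates the l^2 norm. The exponential series is estimated in l^1, where the two
    shifts in the generator are easy to bound. *)
Lemma sum_bound_sq (R : realType) (I : choiceType) (f : I -> R[i]) c :
  sum_bound f c -> sq_bound f (c ^+ 2).
Proof.
move=> fc X; have c0 : 0 <= c.
  by apply: le_trans (fc fset0); rewrite big_seq_fset0.
apply: (@le_trans _ _ (c * \sum_(i <- X) ComplexField.Normc.normc (f i))); last first.
  by rewrite expr2 ler_wpM2l.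
rewrite big_distrr /=; apply: ler_sum => i _; rewrite expr2.
apply: ler_wpM2r; first exact: nc_ge0.
by have := fc [fset i]%fset; rewrite big_seq_fset1.
Qed.

(** * The exponential series on number states *)

Section ExponentialSeries.
Variable R : realType.
Local Notation C := R[i].
Local Notation nc := (@ComplexField.Normc.normc R).
Implicit Types (w : C) (f : nat -> C) (i j k l m N r : nat).

Definition gen_iter w k m : nat -> C := iter m (displacement_gen w) (ket R k).

Lemma gen_iterS w k m : gen_iter w k m.+1 = displacement_gen w (gen_iter w k m).
Proof. by []. Qed.

Lemma gen_iter0 w k j : gen_iter w k 0 j = (j == k)%:R.
Proof. by []. Qed.

Lemma displacement_genE w f j :
  displacement_gen w f j = w * ((Num.sqrt j%:R)%:C * f j.-1)
    - conjc w * ((Num.sqrt j.+1%:R)%:C * f j.+1).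
Proof. by []. Qed.

Lemma gen_iter_supp w k m j : (k + m < j)%N -> gen_iter w k m j = 0.
Proof.
elim: m j => [|m IH] j; first by rewrite addn0 gen_iter0; case: ltngtP.
rewrite addnS gen_iterS displacement_genE => kmj.
rewrite (IH j.-1) ?(IH j.+1) ?mulr0 ?subr0//; last by case: j kmj.
by apply: leqW; exact: ltnW.
Qed.

(** On vectors without components above [k], creation and annihilation are shifts with factors at
    most [Num.sqrt k.+1%:R]; the 2 counts the two of them. *)
Lemma gen_l1_bound w f k (T : R) : (forall j, (k < j)%N -> f j = 0) ->
  (forall N, \sum_(j < N) nc (f j) <= T) ->
  forall N, \sum_(j < N) nc (displacement_gen w f j) <=
    2 * nc w * Num.sqrt k.+1%:R * T.
Proof.
move=> f0 fT N; set q := Num.sqrt _.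
have q0 : 0 <= q by exact: sqrtr_ge0.
have w0 := nc_ge0 w.
apply: (@le_trans _ _ (\sum_(j < N)
   (nc w * q * (if j == 0%N :> nat then 0 else nc (f j.-1)) + nc w * q * nc (f j.+1)))).
  apply: ler_sum => -[j _] _ /=; rewrite displacement_genE.
  apply: (le_trans (ncD _ _)); rewrite ncN !ncM ncJ !ncR !(ger0_norm (sqrtr_ge0 _)).
  rewrite !mulrA; apply: lerD; last first.
    have [kj|jk] := ltnP k j.+1; first by rewrite f0// nc0 !mulr0.
    apply: ler_wpM2r; rewrite ?nc_ge0// ler_wpM2l// ler_wsqrtr// ler_nat.
    exact: leqW.
  case: j => [|j] /=; first by rewrite sqrtr0 !mulr0 mul0r.
  have [kj|jk] := ltnP k j; first by rewrite f0// nc0 !mulr0.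
  by apply: ler_wpM2r; rewrite ?nc_ge0// ler_wpM2l// ler_wsqrtr// ler_nat.
rewrite big_split /= -!big_distrr /= -mulrDr.
rewrite (_ : 2 * nc w * q * T = nc w * q * (T + T)); last by ring.
rewrite ler_wpM2l ?mulr_ge0//; apply: lerD.
  case: N => [|N]; first by rewrite big_ord0; apply: le_trans (fT 0%N); rewrite big_ord0.
  by rewrite big_ord_recl /= add0r; apply: le_trans (fT N).
apply: le_trans (fT N.+1); rewrite big_ord_recl /=.
by rewrite lerDr nc_ge0.
Qed.

(** A bound for the l^1 norm of the [m]-th term of the series. The [i]-th factor is the cost of one
    more generator on a vector supported up to [k + i], divided by the new factor of the
    factorial. *)
Definition gen_weight w k m : R :=
  \prod_(i < m) (2 * nc w * Num.sqrt (k + i).+1%:R / i.+1%:R).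

Lemma gen_weight_ge0 w k m : 0 <= gen_weight w k m.
Proof.
by apply: prodr_ge0 => i _; rewrite divr_ge0// !mulr_ge0// ?nc_ge0 ?sqrtr_ge0.
Qed.

Definition exp_term w k m j : C := gen_iter w k m j / m`!%:R.

Lemma natr_realC n : (n%:R : C) = (n%:R)%:C.
Proof. by rewrite rmorph_nat. Qed.

Lemma gen_iter_l1 w k m N :
  \sum_(j < N) nc (gen_iter w k m j) <= gen_weight w k m * m`!%:R.
Proof.
elim: m N => [|m IH] N.
  rewrite /gen_weight big_ord0 mul1r.
  apply: (@le_trans _ _ (\sum_(j <- [fset i in iota 0 N]%fset) (1 : R) *+ (j == k))).
    rewrite (big_fset_iota (fun j => 1 *+ (j == k))); apply: ler_sum => j _.
    by rewrite gen_iter0; case: eqP; rewrite ?nc1 ?nc0.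
  by rewrite fsum_pred1; case: (_ \in _).
have := gen_l1_bound w (@gen_iter_supp w k m) IH N; rewrite -gen_iterS.
move=> h; apply: (le_trans h).
rewrite /gen_weight big_ord_recr /= factS natrM.
rewrite le_eqVlt; apply/orP; left; apply/eqP.
by field; rewrite gt_eqF// ltr_wpDr.
Qed.

Lemma exp_term_l1 w k m : sum_bound (exp_term w k m) (gen_weight w k m).
Proof.
move=> X; apply: (fsum_nat_le (g := fun j => nc (exp_term w k m j))) => [j|N].
  exact: nc_ge0.
have f0 : 0 < m`!%:R :> R by rewrite ltr0n fact_gt0.
rewrite (eq_bigr (fun j : 'I_N => nc (gen_iter w k m j) / m`!%:R)).
  by rewrite -big_distrl /= ler_pdivrMr// gen_iter_l1.
move=> j _; rewrite /exp_term ncM natr_realC -fmorphV ncR.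
by rewrite ger0_norm// invr_ge0 ltW.
Qed.

Lemma gen_weight_sum w k : exists2 c : R, 0 <= c &
  forall N, \sum_(m < N) gen_weight w k m <= c.
Proof.
(* The ratio of consecutive weights is at most 1/2 when 16 |w|^2 (k + m + 1) <= (m + 1)^2. As k + m
   + 1 <= (k + 1)(m + 1), it suffices that [x] is at most m + 1. *)
pose x := 16 * nc w ^+ 2 * k.+1%:R.
have x0 : 0 <= x by rewrite !mulr_ge0// ?nc_ge0 ?sqr_ge0.
pose M := Num.bound x.
have xM : x < M%:R by have := archi_boundP x0.
apply: (@ratio_sum_bound _ _ M (gen_weight_ge0 w k)) => m Mm.
rewrite {1}/gen_weight big_ord_recr /=; apply: ler_wpM2l; first exact: gen_weight_ge0.
have m0 : 0 < m.+1%:R :> R by rewrite ltr0n.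
rewrite ler_pdivrMr// -(ler_pXn2r (n := 2))//; last 2 first.
- by rewrite nnegrE !mulr_ge0// ?nc_ge0 ?sqrtr_ge0.
- by rewrite nnegrE mulr_ge0.
rewrite !exprMn sqr_sqrtr//.
have h1 : (k + m).+1%:R <= k.+1%:R * m.+1%:R :> R.
  by rewrite -natrM ler_nat -addnS [leqLHS]addnC mulSn mulnS addnA leq_addr.
have h2 : x <= m.+1%:R.
  by apply: (le_trans (ltW xM)); rewrite ler_nat leqW.
have w2 := sqr_ge0 (nc w).
apply: (@le_trans _ _ (2 ^+ 2 * nc w ^+ 2 * (k.+1%:R * m.+1%:R))).
  by rewrite ler_wpM2l// mulr_ge0.
rewrite (_ : 2 ^+ 2 * nc w ^+ 2 * (k.+1%:R * m.+1%:R) = 4^-1 * x * m.+1%:R).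
  rewrite (_ : 2^-1 ^+ 2 * m.+1%:R ^+ 2 = 4^-1 * m.+1%:R * m.+1%:R); last by field.
  by apply: ler_wpM2r; [exact: ltW|rewrite ler_wpM2l].
by rewrite /x; field.
Qed.

Lemma exp_term_bound2 w k : exists2 c : R, 0 <= c & sum_bound2 (exp_term w k) c.
Proof.
have [c c0 hc] := gen_weight_sum w k; exists c => // X Y.
apply: (@le_trans _ _ (\sum_(m <- X) gen_weight w k m)).
  by apply: ler_sum => m _; exact: exp_term_l1.
exact: (fsum_nat_le _ (gen_weight_ge0 w k) hc).
Qed.

Definition exp_col w k j : C := csum (fun m => exp_term w k m j).

Lemma exp_col_has_sum w k j : has_sum (exp_term w k ^~ j) (exp_col w k j).
Proof.
have [c _ hc] := exp_term_bound2 w k.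
exact: csumP (sum_bound2_row j (sum_bound2C hc)).
Qed.

(** D(w)|k> as a vector, before any operator with these columns is known to exist. *)
Definition displaced_ket w k : ell2 R nat := to_ell2 (exp_col w k).
Definition term_vec w k m : ell2 R nat := to_ell2 (exp_term w k m).

Lemma displaced_ketE w k : displaced_ket w k = exp_col w k :> (nat -> C).
Proof.
have [c _ hc] := exp_term_bound2 w k.
have h := sum_bound_rows (sum_bound2C hc) (exp_col_has_sum w k).
exact: to_ell2E (sum_bound_sq h).
Qed.

Lemma term_vecE w k m : term_vec w k m = exp_term w k m :> (nat -> C).
Proof. exact: to_ell2E (sum_bound_sq (@exp_term_l1 w k m)). Qed.

Lemma term_vec_hnorm w k m : hnorm (term_vec w k m) <= gen_weight w k m.
Proof.
apply: hnorm_le; first exact: gen_weight_ge0.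
rewrite term_vecE; exact: sum_bound_sq (@exp_term_l1 w k m).
Qed.

(** The series converges entrywise by construction; this moves it out of an inner product, by Fubini
    over entries and terms. *)
Lemma displaced_ket_inner w k (v : ell2 R nat) :
  has_sum (fun m => inner (term_vec w k m) v) (inner (displaced_ket w k) v).
Proof.
have [c c0 hc] := exp_term_bound2 w k.
apply: (@fubini _ _ _ (fun j m => conjc (exp_term w k m j) * v j)
  (fun j => conjc (displaced_ket w k j) * v j) _ _ (c * hnorm v)).
- apply: sum_bound2C => X Y.
  apply: (@le_trans _ _ ((\sum_(m <- X) \sum_(j <- Y) nc (exp_term w k m j)) * hnorm v)).
    rewrite big_distrl; apply: ler_sum => m _; rewrite big_distrl; apply: ler_sum => j _.
    by rewrite ncM ncJ ler_wpM2l ?nc_ge0// nc_le_hnorm.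
  by rewrite ler_wpM2r// hnorm_ge0.
- move=> j; rewrite displaced_ketE mulrC.
  apply: eq_has_sum (has_sumZ (v j) (has_sumJ (exp_col_has_sum w k j))) => m.
  by rewrite mulrC.
- by move=> m; have := inner_has_sum (term_vec w k m) v; rewrite term_vecE.
- exact: inner_has_sum.
Qed.

End ExponentialSeries.

(** * Displacements as isometries, and their first-order expansion *)

Section Displacement.
Variable R : realType.
Local Notation C := R[i].
Local Notation nc := (@ComplexField.Normc.normc R).
Implicit Types (w : C) (f : nat -> C) (i j k l m N r : nat).

(** The truncated predecessor of 0 is harmless because it comes with [Num.sqrt 0]; [u N = 0] removes
    the other boundary term. *)
Lemma sum_shift (u v : nat -> C) N : u N = 0 ->
  \sum_(j < N.+1) (Num.sqrt j%:R)%:C * (conjc (u j.-1) * v j) =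
  \sum_(j < N.+1) (Num.sqrt j.+1%:R)%:C * (conjc (u j) * v j.+1).
Proof.
move=> uN; rewrite big_ord_recl /= sqrtr0 mul0r add0r.
by rewrite [RHS]big_ord_recr /= uN conjc0 mul0r mulr0 addr0.
Qed.

(** Creation and annihilation are formally adjoint, and the coefficients [w] and minus its conjugate
    turn this into skewness. Vanishing at [N] makes the finite summation by parts exact. *)
Lemma gen_skew w (u v : nat -> C) N : u N = 0 -> v N = 0 ->
  \sum_(j < N.+1) conjc (displacement_gen w u j) * v j =
  - \sum_(j < N.+1) conjc (u j) * displacement_gen w v j.
Proof.
move=> uN vN.
(* [A] pairs the creation of [u] with [v], and the conjugate of [B] pairs [u] with the creation of
   [v]; [sum_shift] rewrites each with annihilation on the other side. *)
pose A := \sum_(j < N.+1) (Num.sqrt j%:R)%:C * (conjc (u j.-1) * v j).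
pose B := \sum_(j < N.+1) (Num.sqrt j%:R)%:C * (conjc (v j.-1) * u j).
have conjB : conjc B = \sum_(j < N.+1) (Num.sqrt j%:R)%:C * (v j.-1 * conjc (u j)).
  rewrite /B; elim/big_ind2: _ => [|x y x' y' <- <-|j _]; first exact: conjc0.
    exact: conjcD.
  by rewrite !conjcM conjc_real conjcK.
have conjB' : conjc B = \sum_(j < N.+1) (Num.sqrt j.+1%:R)%:C * (v j * conjc (u j.+1)).
  rewrite /B sum_shift//; elim/big_ind2: _ => [|x y x' y' <- <-|j _]; first exact: conjc0.
    exact: conjcD.
  by rewrite !conjcM conjc_real conjcK.
transitivity (conjc w * A - w * conjc B).
  rewrite conjB' /A !big_distrr -sumrB /=; apply: eq_bigr => j _.
  by rewrite displacement_genE conjcD conjcN !conjcM !conjc_real conjcK; ring.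
rewrite conjB /A sum_shift// !big_distrr -sumrB -sumrN /=; apply: eq_bigr => j _.
by rewrite displacement_genE; ring.
Qed.

Lemma inner_nat_fin (u v : ell2 R nat) N : (forall j, (N <= j)%N -> u j = 0) ->
  inner u v = \sum_(j < N) conjc (u j) * v j.
Proof.
move=> u0; apply: has_sum_unique (inner_has_sum u v) _.
by apply: (has_sum_nat_fin (f := fun j => conjc (u j) * v j)) => j /u0 ->; rewrite conjc0 mul0r.
Qed.

(** The [m] generators on the left cross the inner product one at a time, each with a sign, leaving
    a matrix element of the power [m + l]. *)
Lemma inner_term_vec w i k m l :
  inner (term_vec w i m) (term_vec w k l) =
  (-1) ^+ m * gen_iter w k (m + l) i / m`!%:R / l`!%:R.
Proof.
(* A generous cutoff beyond the support of every iterate met while generators are moved. *)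
pose N := (i + k + m + l + m + l).+1.
have supp (a b : nat) j : (a <= i + k)%N -> (b <= m + l + m + l)%N -> (N <= j)%N ->
    gen_iter w a b j = 0.
  move=> ha hb hj; apply: gen_iter_supp; apply: leq_trans hj.
  by rewrite /N; lia.
have -> : inner (term_vec w i m) (term_vec w k l) =
    (\sum_(j < N.+1) conjc (gen_iter w i m j) * gen_iter w k l j) / m`!%:R / l`!%:R.
  rewrite (@inner_nat_fin _ _ N.+1); last first.
    by move=> j hj; rewrite term_vecE /exp_term supp ?mul0r//; lia.
  rewrite !term_vecE !big_distrl /=; apply: eq_bigr => j _.
  by rewrite /exp_term conjcM conjc_inv conjc_nat; ring.
congr (_ / _ / _).
have step a b : (a + b <= m + l)%N ->
   \sum_(j < N.+1) conjc (gen_iter w i a j) * gen_iter w k b j =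
   (-1) ^+ a * \sum_(j < N.+1) conjc (gen_iter w i 0 j) * gen_iter w k (a + b) j.
  elim: a b => [|a IH] b hab; first by rewrite mul1r.
  rewrite gen_iterS gen_skew -?gen_iterS.
  - by rewrite IH ?addnS// exprS mulN1r mulNr addSn.
  - by apply: supp; lia.
  - by apply: supp; lia.
rewrite step//; congr (_ * _).
rewrite (eq_bigr (fun j : 'I_N.+1 => gen_iter w k (m + l) i *+ (val j == i))); last first.
  move=> j _; rewrite gen_iter0; case: eqP => [->|] /=.
    by rewrite conjc1 mul1r.
  by rewrite conjc0 mul0r.
rewrite -(big_fset_iota (fun j => gen_iter w k (m + l) i *+ (j == i))) fsum_pred1.
have -> // : i \in [fset j in iota 0 N.+1]%fset.
by rewrite mem_fset_iota /N; lia.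
Qed.

(* The double series for the inner product, regrouped along [m + l = r], has
   the coefficient [(1 - 1) ^ r / r!] in front of [<i| G^r |k>]. *)
Lemma displaced_ket_orthonormal w : orthonormal_family (displaced_ket w).
Proof.
move=> i k.
have [ci ci0 hci] := gen_weight_sum w i; have [ck ck0 hck] := gen_weight_sum w k.
pose F m l := inner (term_vec w i m) (term_vec w k l).
pose F' m r := if (m <= r)%N then F m (r - m)%N else 0.
have Fle m l : nc (F m l) <= gen_weight w i m * gen_weight w k l.
  apply: (le_trans (inner_le _ _)).
  by apply: ler_pM; rewrite ?hnorm_ge0// term_vec_hnorm.
have F'row m N : \sum_(r < N) nc (F' m r) <= gen_weight w i m * ck.
  have [Nm|mN] := leqP N m.
    rewrite big1 ?mulr_ge0 ?gen_weight_ge0// => r _.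
    by rewrite /F' leqNgt (leq_trans (ltn_ord r) Nm) nc0.
  rewrite -(big_mkord predT (fun r => nc (F' m r))) (big_cat_nat _ (ltnW mN))//=.
  rewrite big_nat big1 ?add0r; last first.
    by move=> r /andP[_ rm]; rewrite /F' leqNgt rm nc0.
  rewrite -{1}[m]add0n big_addn.
  apply: (@le_trans _ _ (\sum_(0 <= l < N - m) gen_weight w i m * gen_weight w k l)).
    by apply: ler_sum => l _; rewrite /F' leq_addl addnK.
  by rewrite -big_distrr /= ler_wpM2l ?gen_weight_ge0// big_mkord.
have F'b : sum_bound2 F' (ci * ck).
  move=> X Y; apply: (@le_trans _ _ (\sum_(m <- X) gen_weight w i m * ck)).
    apply: ler_sum => m _.
    by apply: (fsum_nat_le (g := fun r => nc (F' m r))) => // r; exact: nc_ge0.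
  rewrite -big_distrl /= ler_wpM2r//.
  by apply: (fsum_nat_le (g := gen_weight w i)) => // m; exact: gen_weight_ge0.
have F's m : has_sum (F' m) (inner (term_vec w i m) (displaced_ket w k)).
  have h1 := csumP (sum_bound2_row m F'b).
  have h2 : has_sum (F m) (inner (term_vec w i m) (displaced_ket w k)).
    rewrite innerC; apply: eq_has_sum (has_sumJ (displaced_ket_inner w k _)) => l.
    by rewrite -innerC.
  have -> // : inner (term_vec w i m) (displaced_ket w k) = csum (F' m).
  apply: has_sum_unique h2 _.
  have := has_sum_reindex (sum_bound2_row m F'b) (@addnI m) _ h1.
  have -> : F' m \o addn m = F m.
    by apply/funext => l; rewrite /F' /= leq_addr addKn.
  apply=> r hr; rewrite /F'; case: leqP => // mr.
  by have := hr (r - m)%N; rewrite subnKC// eqxx.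
pose S r := \sum_(m < r.+1) F' m r.
have S's r : has_sum (F'^~ r) (S r).
  by apply: (has_sum_nat_fin (f := F'^~ r)) => m; rewrite /F' => /ltn_geF ->.
have Sr r : r != 0%N -> S r = 0.
  case: r => // r _; rewrite /S.
  pose x := gen_iter w k r.+1 i / r.+1`!%:R.
  transitivity (x * (1 - 1) ^+ r.+1); last by rewrite subrr expr0n mulr0.
  rewrite exprBn big_distrr /=; apply: eq_bigr => m _.
  have mr : (m <= r.+1)%N by rewrite -ltnS.
  rewrite /F' mr /F inner_term_vec subnKC// !expr1n !mulr1 /x.
  rewrite -(bin_fact mr) !natrM -mulr_natr.
  have f1 : m`!%:R != 0 :> C by rewrite pnatr_eq0 -lt0n fact_gt0.
  have f2 : (r.+1 - m)`!%:R != 0 :> C by rewrite pnatr_eq0 -lt0n fact_gt0.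
  have f3 : 'C(r.+1, m)%:R != 0 :> C by rewrite pnatr_eq0 -lt0n bin_gt0.
  by field; rewrite f1 f2 f3.
have S0 : S 0%N = (i == k)%:R.
  rewrite /S big_ord1 /F' leqnn subnn /F inner_term_vec addn0 gen_iter0 fact0 expr0.
  by rewrite mul1r !divr1.
rewrite -S0; apply: has_sum_unique (has_sum1 Sr).
exact: fubini F'b F's S's (displaced_ket_inner w i _).
Qed.

Lemma gen_iter_scale (s : R) w k m j :
  gen_iter (s%:C * w) k m j = s%:C ^+ m * gen_iter w k m j.
Proof.
elim: m j => [|m IH] j; first by rewrite mul1r.
rewrite !gen_iterS !displacement_genE !IH exprS conjcM conjc_real.
by ring.
Qed.

(** The term of order [m] scales by [s ^+ m], which is at most [s ^+ 2] in modulus for [m >= 2] and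
    [|s| <= 1]. Hence [K] can be the absolute bound of the whole series at [s = 1]. *)
Lemma displaced_ket_first_order w k : exists2 K : R, 0 <= K &
  forall s : R, `|s| <= 1 ->
    hnorm (displaced_ket (s%:C * w) k - ket R k - s%:C *: term_vec w k 1)
      <= K * s ^+ 2.
Proof.
have [K K0 hK] := exp_term_bound2 w k; exists K => // s s1.
pose F m j := if (m < 2)%N then 0 else exp_term (s%:C * w) k m j.
have Fb : sum_bound2 F (K * s ^+ 2).
  move=> X Y; apply: (@le_trans _ _ ((\sum_(m <- X) \sum_(j <- Y) nc (exp_term w k m j)) * s ^+ 2)).
    rewrite big_distrl; apply: ler_sum => m _; rewrite big_distrl; apply: ler_sum => j _ /=.
    rewrite /F; case: ltnP => m2; first by rewrite nc0 mulr_ge0 ?nc_ge0 ?sqr_ge0.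
    rewrite /exp_term gen_iter_scale -mulrA ncM mulrC ler_wpM2l ?nc_ge0//.
    rewrite ncX ncR -(subnKC m2) exprD real_normK ?num_real// -[leRHS]mulr1.
    by rewrite ler_wpM2l ?sqr_ge0// exprn_ile1.
  by rewrite ler_wpM2r ?sqr_ge0.
have Fs j : has_sum (F^~ j)
   ((displaced_ket (s%:C * w) k - ket R k - s%:C *: term_vec w k 1) j).
  have h := exp_col_has_sum (s%:C * w) k j; rewrite -displaced_ketE in h.
  pose f m := if (m < 2)%N then exp_term (s%:C * w) k m j else 0.
  have hf : has_sum f (\sum_(m < 2) f m).
    by apply: has_sum_nat_fin => m; rewrite /f leqNgt => /negPf ->.
  have -> : (displaced_ket (s%:C * w) k - ket R k - s%:C *: term_vec w k 1) j =
    displaced_ket (s%:C * w) k j + -1 * \sum_(m < 2) f m.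
    rewrite !ell2D !ell2N ell2Z term_vecE ketE !big_ord_recl big_ord0 /f /= /exp_term.
    rewrite !gen_iter_scale gen_iter0 /=. rewrite expr0 expr1 fact0 !divr1; ring.
  apply: eq_has_sum (has_sumD h (has_sumZ (-1) hf)) => m.
  by rewrite /f /F; case: ifP => _; ring.
apply: hnorm_le; first by rewrite mulr_ge0 ?sqr_ge0.
exact: sum_bound_sq (sum_bound_rows (sum_bound2C Fb) Fs).
Qed.

(** For [k = 0] the truncated [k.-1] carries the coefficient [Num.sqrt 0], so the vacuum needs no
    separate formula. *)
Lemma term_vec1 w k : term_vec w k 1 =
  (w * (Num.sqrt k.+1%:R)%:C) *: ket R k.+1 -
  (conjc w * (Num.sqrt k%:R)%:C) *: ket R k.-1.
Proof.
apply: ell2P => j; rewrite term_vecE /exp_term divr1 gen_iterS displacement_genE.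
rewrite !gen_iter0 ell2D ell2N !ell2Z !ketE -!mulrA; congr (_ * _ - _ * _).
  case: j => [|j] /=; first by rewrite sqrtr0 mul0r mulr0.
  by rewrite eqSS; case: eqP => [->|]//; rewrite !mulr0.
case: k => [|k] /=; first by rewrite sqrtr0 mul0r mulr0.
by rewrite eqSS; case: eqP => [->|]//; rewrite !mulr0.
Qed.

(** Orthonormality of the columns yields an isometry with the matrix of the exponential series, and
    the choice in [displacement] must return it. *)
Lemma displacementP w : [/\ bounded_op (displacement w),
  forall k, displacement w (ket R k) = displaced_ket w k &
  adj (displacement w) \o displacement w = id].
Proof.
have [V [bV Vk VV]] := synthesis (@displaced_ket_orthonormal w).
suff -> : displacement w = V by [].
apply: op_of_mxE => // j k; rewrite Vk inner_ketl displaced_ketE.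
by [].
Qed.

End Displacement.

(** * Thermal states and the first mode *)

Section ThermalWeights.
Variable R : realType.
Local Notation C := R[i].
Local Notation nc := (@ComplexField.Normc.normc R).
Implicit Types (N : R) (k m : nat).

Definition thermal_weight N k : R := (N + 1)^-1 * (N / (N + 1)) ^+ k.

Definition tuple_weight N m (t : m.-tuple nat) : R :=
  \prod_(i < m) thermal_weight N (tnth t i).

Definition tuple_hd m (l : m.+1.-tuple nat) : nat := head 0%N l.
Definition tuple_tl m (l : m.+1.-tuple nat) : m.-tuple nat := [tuple of behead l].
Definition tuple_mk m (x : nat) (t : m.-tuple nat) : m.+1.-tuple nat :=
  [tuple of x :: t].

Lemma tuple_hdK m x (t : m.-tuple nat) : tuple_hd (tuple_mk x t) = x.
Proof. by []. Qed.
Lemma tuple_tlK m x (t : m.-tuple nat) : tuple_tl (tuple_mk x t) = t.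
Proof. exact: val_inj. Qed.
Lemma tuple_mkK m (l : m.+1.-tuple nat) : tuple_mk (tuple_hd l) (tuple_tl l) = l.
Proof. by apply: val_inj; rewrite /=; case/tupleP: l. Qed.

Lemma thermal_weight_ge0 N k : 0 < N -> 0 <= thermal_weight N k.
Proof.
by move=> N0; rewrite mulr_ge0 ?exprn_ge0 ?divr_ge0 ?invr_ge0 ?addr_ge0 ?ltW.
Qed.

Lemma thermal_weight_bound N : 0 < N ->
  sum_bound (fun k => (thermal_weight N k)%:C) 1.
Proof.
move=> N0; have p0 k := thermal_weight_ge0 k N0.
apply: (sum_bound_le (g := thermal_weight N)) => [k|X].
  by rewrite ncR ger0_norm.
apply: fsum_nat_le => // K.
suff -> : \sum_(i < K) thermal_weight N i = 1 - (N / (N + 1)) ^+ K.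
  by rewrite gerBl exprn_ge0// divr_ge0 ?addr_ge0// ltW.
elim: K => [|K IH]; first by rewrite big_ord0 expr0 subrr.
rewrite big_ord_recr /= IH /thermal_weight exprS; field.
by rewrite gt_eqF// addr_gt0.
Qed.

(** Shifting the index multiplies the weights by N/(N+1), so the sum [s] satisfies s - 1/(N+1) = s
    N/(N+1). *)
Lemma thermal_weight_has_sum N : 0 < N ->
  has_sum (fun k => (thermal_weight N k)%:C) 1.
Proof.
move=> N0; have fb := thermal_weight_bound N0; have fs := csumP fb.
pose f k := (thermal_weight N k)%:C : C; set s := csum _ in fs.
have q0 : N + 1 != 0 by rewrite gt_eqF// addr_gt0.
pose f' k := if k == 0%N then 0 else f k.
have f's : has_sum f' (s + -1 * f 0%N).
  have h : has_sum (fun k => if k == 0%N then f k else 0) (f 0%N).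
    exact: (@has_sum1 _ _ (fun k => if k == 0%N then f k else 0) 0%N (fun j => ltac:(by move/negPf => ->))).
  apply: eq_has_sum (has_sumD fs (has_sumZ (-1) h)) => k.
  by rewrite /f' /f; case: eqP => _; ring.
have f'b : sum_bound f' 1.
  move=> X; apply: le_trans (fb X); apply: ler_sum => k _; rewrite /f'.
  by case: eqP; rewrite // nc0 nc_ge0.
have shifted : has_sum (f' \o succn) (s + -1 * f 0%N).
  apply: has_sum_reindex f'b succn_inj _ f's => -[|k] hk //.
  by have := hk k; rewrite eqxx.
have scaled := has_sumZ ((N / (N + 1))%:C) fs.
have e : s + -1 * f 0%N = (N / (N + 1))%:C * s.
  apply: has_sum_unique shifted _; apply: eq_has_sum scaled => k.
  by rewrite /f' /f /= -rmorphM /= /thermal_weight exprS; congr (_%:C); ring.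
suff <- : s = 1 by [].
have e1 : s * (1 - (N / (N + 1))%:C) = ((N + 1)^-1)%:C.
  rewrite mulrBr mulr1 [s * _]mulrC -e /f /thermal_weight expr0 mulr1; ring.
have e2 : 1 - (N / (N + 1))%:C = ((N + 1)^-1)%:C :> C.
  by rewrite -[1]/(1%:C) -rmorphB; congr (_%:C); field.
apply: (mulIf (x := ((N + 1)^-1)%:C)); last by rewrite mul1r -{1}e2.
by rewrite -(rmorph0 (real_complex R)) (inj_eq (@complexI R)) invr_eq0.
Qed.

Lemma tuple_weight_mk N m x (t : m.-tuple nat) :
  tuple_weight N (tuple_mk x t) = thermal_weight N x * tuple_weight N t.
Proof.
rewrite /tuple_weight big_ord_recl tnth0; congr (_ * _).
by apply: eq_bigr => i _; rewrite tnthS.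
Qed.

Lemma tuple_weight_split N m (l : m.+1.-tuple nat) :
  tuple_weight N l = thermal_weight N (tuple_hd l) * tuple_weight N (tuple_tl l).
Proof. by rewrite -tuple_weight_mk tuple_mkK. Qed.

Lemma tuple_weight_ge0 N m (t : m.-tuple nat) : 0 < N -> 0 <= tuple_weight N t.
Proof. by move=> N0; apply: prodr_ge0 => i _; exact: thermal_weight_ge0. Qed.

Lemma tuple_weight_sum N m : 0 < N ->
  sum_bound (fun t : m.-tuple nat => (tuple_weight N t)%:C) 1 /\
  has_sum (fun t : m.-tuple nat => (tuple_weight N t)%:C) 1.
Proof.
move=> N0; elim: m => [|m [IHb IHs]].
  have e (t : 0.-tuple nat) : (tuple_weight N t)%:C = 1 by rewrite /tuple_weight big_ord0.
  split=> [X|].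
    rewrite (eq_bigr (fun t => 1 *+ (t == [tuple]))).
      by rewrite fsum_pred1; case: (_ \in _).
    by move=> t _; rewrite e nc1 tuple0 eqxx.
  have := @has_sum1 _ _ (fun t : 0.-tuple nat => (tuple_weight N t)%:C) [tuple].
  by rewrite e; apply=> t; rewrite tuple0 eqxx.
have E : (fun l : m.+1.-tuple nat => (tuple_weight N l)%:C) =
   fun l => (thermal_weight N (tuple_hd l))%:C * (tuple_weight N (tuple_tl l))%:C.
  by apply/funext => l; rewrite tuple_weight_split rmorphM.
rewrite E; split.
  rewrite -[X in sum_bound _ X]mulr1.
  apply: (sum_bound_split (@tuple_mkK m) (thermal_weight_bound N0) IHb).
rewrite -[X in has_sum _ X]mulr1.
exact: (has_sum_split (@tuple_hdK m) (@tuple_tlK m) (@tuple_mkK m)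
  (thermal_weight_bound N0) IHb (thermal_weight_has_sum N0) IHs).
Qed.

Lemma tuple_weight_fsum N m : 0 < N -> forall X : {fset m.-tuple nat},
  \sum_(t <- X) tuple_weight N t <= 1.
Proof.
move=> N0 X; apply: le_trans ((tuple_weight_sum m N0).1 X).
by apply: ler_sum => t _; rewrite ncR ler_norm.
Qed.

Lemma tuple_weight_le1 N m (t : m.-tuple nat) : 0 < N -> `|tuple_weight N t| <= 1.
Proof.
move=> N0; have := tuple_weight_fsum N0 [fset t]%fset.
by rewrite big_seq_fset1 ger0_norm// tuple_weight_ge0.
Qed.

Lemma thermal_weight_le1 N k : 0 < N -> `|thermal_weight N k| <= 1.
Proof.
move=> N0; have := thermal_weight_bound N0 [fset k]%fset.
by rewrite big_seq_fset1 ncR.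
Qed.

Lemma thermalE N : 0 < N -> thermal N = diag (thermal_weight N).
Proof.
move=> N0; apply: (op_of_mx_diag (K := 1)) => [k|j k].
  exact: thermal_weight_le1.
by case: eqP => [->|_]; rewrite ?mul1r ?mul0r.
Qed.

Lemma tensor_power_thermal N m : 0 < N ->
  tensor_power m (thermal N) = diag (@tuple_weight N m).
Proof.
move=> N0; apply: (op_of_mx_diag (K := 1)) => [t|k l].
  exact: tuple_weight_le1.
have w1 := fun k => thermal_weight_le1 k N0.
have E i : inner (ket R (tnth k i)) (thermal N (ket R (tnth l i))) =
    (tnth k i == tnth l i)%:R * (thermal_weight N (tnth k i))%:C.
  rewrite thermalE// (diag_ket _ w1) innerZr inner_ketl ketE mulrC.
  by case: eqP => [->|]//; rewrite !mul0r.
rewrite (eq_bigr _ (fun i _ => E i)) big_split /=; congr (_ * _); last first.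
  by rewrite /tuple_weight rmorph_prod.
case: (eqVneq k l) => [->|kl].
  by rewrite big1// => i _; rewrite eqxx.
have [i /negPf kli] : exists i, tnth k i != tnth l i.
  apply/existsP; rewrite -negb_forall; apply: contra kl => /forallP h.
  by apply/eqP/eq_from_tnth => i; apply/eqP.
by rewrite (bigD1 i)//= kli mul0r.
Qed.

End ThermalWeights.

(** * Splitting off the first mode *)

Section FirstMode.
Variables (R : realType) (m : nat).
Local Notation C := R[i].
Local Notation nc := (@ComplexField.Normc.normc R).
Local Notation L := (m.+1.-tuple nat).
Local Notation J := (m.-tuple nat).
Implicit Types (u v : ell2 R nat) (t : J) (l : L) (w : C).

(** The product vector of [u] in the first mode and the number state [t] in the others. *)
Definition embed t u : ell2 R L :=
  to_ell2 (fun l => u (tuple_hd l) *+ (tuple_tl l == t)).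

Lemma embedE t u l : embed t u l = u (tuple_hd l) *+ (tuple_tl l == t).
Proof.
have hb : sq_bound (fun l => u (tuple_hd l) *+ (tuple_tl l == t)) (hnorm u ^+ 2).
  move=> X; pose F x s := nc (u x) ^+ 2 *+ (s == t).
  rewrite (eq_bigr (fun l => F (tuple_hd l) (tuple_tl l))); last first.
    by move=> k _; rewrite /F; case: eqP; rewrite ?mulr0n ?nc0 ?expr0n.
  have F0 x s : 0 <= F x s by rewrite mulrn_wge0// sqr_ge0.
  apply: (le_trans (fsum_split_le X (split_inj (@tuple_mkK m)) F0)).
  apply: le_trans (@sq_bound_hnorm _ _ u (@tuple_hd m @` X)%fset).
  apply: ler_sum => x _; rewrite /F fsum_pred1.
  by case: (_ \in _); rewrite ?mulr0n ?sqr_ge0.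
by rewrite /embed (to_ell2E hb).
Qed.

Lemma inner_embed t s u v :
  inner (embed t u) (embed s v) = (t == s)%:R * inner u v.
Proof.
have := inner_has_sum (embed t u) (embed s v).
have [->|/negPf ts] := eqVneq t s; last first.
  move=> h; rewrite mul0r; apply: has_sum_unique h _.
  apply: eq_has_sum (@has_sum0 R _) => l; rewrite !embedE.
  by case: eqP => [->|]; rewrite ?ts ?mulr0n ?mulr0 ?conjc0 ?mul0r.
rewrite mul1r => h; apply/esym; apply: has_sum_unique (inner_has_sum u v) _.
have inj : injective (fun x => tuple_mk x s).
  by move=> x y /(congr1 (@tuple_hd m)).
have := has_sum_reindex (@cauchy_schwarz_bound _ _ (embed s u) (embed s v)) inj _ h.
set f := _ \o _.
have -> : f = fun x => conjc (u x) * v x.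
  by apply/funext => x; rewrite /f /= !embedE tuple_hdK tuple_tlK eqxx.
apply=> l hl; rewrite !embedE; case: eqP => [e|]; last by rewrite mulr0.
by have := hl (tuple_hd l); rewrite -e tuple_mkK eqxx.
Qed.

Lemma hnorm_embed t u : hnorm (embed t u) = hnorm u.
Proof.
have := inner_embed t t u u; rewrite !inner_self eqxx mul1r => /complexI.
by move=> /eqP; rewrite eqrXn2 ?hnorm_ge0// => /eqP.
Qed.

Lemma embedZ t (a : C) u : embed t (a *: u) = a *: embed t u.
Proof. by apply: ell2P => l; rewrite !(ell2Z, embedE) mulrnAr. Qed.

Lemma embedD t u v : embed t (u + v) = embed t u + embed t v.
Proof. by apply: ell2P => l; rewrite !(ell2D, embedE) mulrnDl. Qed.

Lemma embed_ket t x : embed t (ket R x) = ket R (tuple_mk x t).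
Proof.
apply: ell2P => l; rewrite embedE !ketE.
have -> : (l == tuple_mk x t) = (tuple_hd l == x) && (tuple_tl l == t).
  apply/eqP/andP => [->|[/eqP <- /eqP <-]]; last by rewrite tuple_mkK.
  by rewrite tuple_hdK tuple_tlK !eqxx.
by do 2!case: (_ == _).
Qed.

Definition shift_first w : modes R m.+1 := tensor_first (displacement w) id.

(** The columns are product vectors of a displaced ket and a number state, hence orthonormal, and
    [synthesis] applies as for one mode. *)
Lemma shift_firstP w : [/\ bounded_op (shift_first w),
  forall l, shift_first w (ket R l) =
    embed (tuple_tl l) (displaced_ket w (tuple_hd l)) &
  adj (shift_first w) \o shift_first w = id].
Proof.
have [bD Dk _] := displacementP w.
pose d l := embed (tuple_tl l) (displaced_ket w (tuple_hd l)).
have od : orthonormal_family d.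
  move=> k l; rewrite inner_embed displaced_ket_orthonormal -natrM mulnb.
  by rewrite andbC -xpair_eqE (inj_eq (split_inj (@tuple_mkK m))).
have [V [bV Vk VV]] := synthesis od.
suff -> : shift_first w = V by [].
apply: op_of_mxE => // k l; rewrite Vk inner_ketl embedE Dk.
by rewrite -!/(tuple_hd _) inner_ketl inner_ketl ketE mulr_natr.
Qed.

Lemma adj_shift_first_ket w l :
  adj (shift_first w) (ket R l) =
  embed (tuple_tl l) (adj (displacement w) (ket R (tuple_hd l))).
Proof.
have [bW Wk _] := shift_firstP w; have [bD Dk _] := displacementP w.
apply: ell2P => k; rewrite -[LHS]inner_ketl inner_adjr// Wk inner_ketr !embedE.
rewrite -[in RHS]inner_ketl inner_adjr// Dk inner_ketr eq_sym.
by case: eqP; rewrite ?conjc0.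
Qed.

(** Used for product thermal weights, with [a] the weight of the tail, and for tail indicators, with
    [p] constant. *)
Lemma diag_embed (q : L -> R) (p : nat -> R) (a b c : R) t u :
  (forall l, `|q l| <= b) -> (forall x, `|p x| <= c) ->
  (forall l, tuple_tl l = t -> q l = p (tuple_hd l) * a) ->
  diag q (embed t u) = a%:C *: embed t (diag p u).
Proof.
move=> qb pc qp; apply: ell2P => l.
rewrite (diagE _ _ qb) ell2Z !embedE (diagE _ _ pc); case: eqP => [e|].
  by rewrite qp// rmorphM /=; ring.
by rewrite !mulr0.
Qed.

Definition tail_indicator (S : set nat) l : R :=
  `[< S (\sum_(i < m) tnth (tuple_tl l) i)%N >]%:R.

Lemma tail_indicator_le1 S l : `|tail_indicator S l| <= 1.
Proof. by rewrite /tail_indicator; case: `[< _ >]; rewrite ?normr0 ?normr1. Qed.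

Lemma number_projE k (S : set nat) : number_proj k S =
  diag (fun t : k.-tuple nat => `[< S (\sum_(i < k) tnth t i)%N >]%:R : R).
Proof.
apply: (op_of_mx_diag (K := 1)) => [t|s t].
  by case: `[< _ >]; rewrite ?normr0 ?normr1.
by case: eqP => [->|]; rewrite ?mul0r//= mul1r; case: `[< _ >].
Qed.

Lemma tensor_first_number_proj (S : set nat) :
  @tensor_first R m.+1 id (number_proj m S) = diag (tail_indicator S).
Proof.
apply: (op_of_mx_diag (tail_indicator_le1 S)) => k l.
rewrite number_projE (diag_ket (K := 1)); last first.
  by move=> t; case: `[< _ >]; rewrite ?normr0 ?normr1.
rewrite innerZr !inner_ketl !ketE -!/(tuple_hd _) -!/(tuple_tl _).
rewrite (_ : (k == l) = (tuple_hd k == tuple_hd l) && (tuple_tl k == tuple_tl l)).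
  rewrite /tail_indicator; case: (tuple_hd k == _); rewrite ?mul0r ?mul1r//=.
  by case: (tuple_tl k =P _) => [->|]; rewrite ?mulr0 ?mul0r ?mul1r ?mulr1.
by rewrite -xpair_eqE (inj_eq (split_inj (@tuple_mkK m))).
Qed.

(** On the slice with a fixed tail, the product weight is the one-mode thermal weight times a
    constant, so the matrix elements of both sides factor alike. *)
Lemma tensor_first_displaced_thermal w (N : R) : 0 < N ->
  @tensor_first R m.+1 (displaced_thermal w N) (tensor_power m (thermal N)) =
  shift_first w \o diag (@tuple_weight R N m.+1) \o adj (shift_first w).
Proof.
move=> N0; have [bW _ _] := shift_firstP w; have [bD _ _] := displacementP w.
have b1 := fun l : L => tuple_weight_le1 l N0.
have b2 := fun k => thermal_weight_le1 k N0.
apply: op_of_mxE.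
  apply: bounded_comp (bounded_adj bW); apply: bounded_comp => //.
  exact: diag_bounded b1.
move=> k l /=; rewrite -inner_adjl// !adj_shift_first_ket.
rewrite (diag_embed (a := tuple_weight N (tuple_tl l)) _ b1 b2); last first.
  by move=> l' e; rewrite tuple_weight_split e.
rewrite innerZr inner_embed inner_adjl// -!/(tuple_hd _) -!/(tuple_tl _).
rewrite tensor_power_thermal// /displaced_thermal thermalE//=.
rewrite (diag_ket (K := 1)); last by move=> t; exact: tuple_weight_le1.
by rewrite innerZr !inner_ketl ketE; ring.
Qed.

End FirstMode.

(** * Invariant operators *)

Section Invariance.
Variables (R : realType) (m : nat).
Local Notation C := R[i].
Local Notation nc := (@ComplexField.Normc.normc R).
Local Notation L := (m.+1.-tuple nat).
Local Notation J := (m.-tuple nat).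

Lemma inner_self_eq1 (I : choiceType) (u : ell2 R I) : inner u u = 1 -> hnorm u = 1.
Proof.
rewrite inner_self => /(congr1 (@complex.Re R)) /= /eqP.
by rewrite -[X in _ == X](expr1n _ 2) eqrXn2 ?hnorm_ge0// => /eqP.
Qed.

Lemma hnorm_displaced_ket w k : hnorm (displaced_ket (R := R) w k) = 1.
Proof. by apply: inner_self_eq1; rewrite displaced_ket_orthonormal eqxx. Qed.

Lemma hnorm_ket (I : choiceType) (i : I) : hnorm (ket R i) = 1.
Proof. by apply: inner_self_eq1; rewrite orthonormal_ket eqxx. Qed.

Lemma sqrt_succ_neq0 n : (Num.sqrt n.+1%:R)%:C != 0 :> C.
Proof.
by rewrite -(rmorph0 (real_complex R)) (inj_eq (@complexI R)) sqrtr_eq0 lern0.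
Qed.

Section Form.
Variables (A : op R L) (t : J).
Hypotheses (bA : bounded_op A)
  (invA : forall w, adj (@shift_first R m w) \o A \o @shift_first R m w = A).
Implicit Types u v : ell2 R nat.

(** The compression of [A] to the slice with residual tuple [t], where only the first mode is
    left. *)
Let form u v := inner (embed t u) (A (embed t v)).

Let formDl u u' v : form (u + u') v = form u v + form u' v.
Proof. by rewrite /form embedD innerDl. Qed.
Let formDr u v v' : form u (v + v') = form u v + form u v'.
Proof. by rewrite /form embedD opD// innerDr. Qed.
Let formZl (a : C) u v : form (a *: u) v = conjc a * form u v.
Proof. by rewrite /form embedZ innerZl. Qed.
Let formZr (a : C) u v : form u (a *: v) = a * form u v.
Proof. by rewrite /form embedZ opZ// innerZr. Qed.
Let formNl u v : form (- u) v = - form u v.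
Proof. by rewrite -scaleN1r formZl conjcN conjc1 mulN1r. Qed.
Let formNr u v : form u (- v) = - form u v.
Proof. by rewrite -scaleN1r formZr mulN1r. Qed.

Let form_bound : exists2 c : R, 0 <= c &
  forall u v, nc (form u v) <= c * hnorm u * hnorm v.
Proof.
have [c c0 hc] := bounded_opE bA; exists c => // u v.
apply: (le_trans (inner_le _ _)); rewrite mulrAC [leRHS]mulrC hnorm_embed.
by rewrite ler_wpM2l ?hnorm_ge0// (le_trans (hc _))// hnorm_embed.
Qed.

Let form_inv w i j :
  form (displaced_ket w i) (displaced_ket w j) = form (ket R i) (ket R j).
Proof.
have [bW Wk _] := shift_firstP m w.
have e k : embed t (displaced_ket w k) = @shift_first R m w (ket R (tuple_mk k t)).
  by rewrite Wk tuple_hdK tuple_tlK.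
rewrite /form !e !embed_ket -inner_adjr//.
have /(congr1 (fun f => f (ket R (tuple_mk j t)))) /= -> := invA w.
by [].
Qed.

(* Differentiates [form_inv] along [s |-> s w] at [s = 0]. *)
Let form_skew w i j :
  form (term_vec w i 1) (ket R j) + form (ket R i) (term_vec w j 1) = 0.
Proof.
have [c c0 hc] := form_bound.
have [Ki Ki0 hi] := displaced_ket_first_order w i.
have [Kj Kj0 hj] := displaced_ket_first_order w j.
set gi := term_vec w i 1; set gj := term_vec w j 1.
set X := _ + _.
(* After cancellation of the zeroth order, [s%:C * X] equals minus four remainders, each at most
   [s ^+ 2] times one of these summands. Dividing by [s] leaves a bound that tends to 0. *)
pose K := c * hnorm gi * hnorm gj + c * hnorm gi * Kj + c * Ki + c * Kj.
have K0 : 0 <= K by rewrite !addr_ge0 ?mulr_ge0 ?hnorm_ge0.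
have Xs (s : R) : 0 < s -> s <= 1 -> nc X <= s * K.
  move=> s0 s1.
  have as1 : `|s| <= 1 by rewrite gtr0_norm.
  pose di := displaced_ket (s%:C * w) i; pose dj := displaced_ket (s%:C * w) j.
  pose ri := di - ket R i - s%:C *: gi; pose rj := dj - ket R j - s%:C *: gj.
  have := hi s as1; rewrite -/di -/gi -/ri => hri.
  have := hj s as1; rewrite -/dj -/gj -/rj => hrj.
  have Dj : dj = ket R j + s%:C *: gj + rj by rewrite /rj -[_ - _ - _]addrA -opprD [RHS]addrC subrK.
  have Di : di = ket R i + s%:C *: gi + ri by rewrite /ri -[_ - _ - _]addrA -opprD [RHS]addrC subrK.
  clearbody ri rj.
  have E : s%:C * X = - (s%:C * s%:C * form gi gj + s%:C * form gi rj
      + form ri dj + form (ket R i) rj).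
    have e1 := form_inv (s%:C * w) i j; rewrite -/di -/dj in e1.
    rewrite {1}Di !formDl formZl conjc_real {1 2}Dj !formDr !formZr in e1.
    apply/eqP; rewrite /X -subr_eq0; apply/eqP; move: e1.
    move: (form (ket R i) (ket R j)) (form (ket R i) gj) (form (ket R i) rj)
      (form gi (ket R j)) (form gi gj) (form gi rj) (form ri dj).
    move=> a b x c' y z q e1.
    transitivity (a + s%:C * b + x + s%:C * (c' + s%:C * y + z) + q - a); first by ring.
    by rewrite e1 subrr.
  have s0' := ltW s0.
  have : s * nc X <= s * (s * K).
    have -> : s * nc X = nc (s%:C * X) by rewrite ncM ncR gtr0_norm.
    rewrite E ncN; apply: (le_trans (ncD _ _)).
    rewrite (_ : s * (s * K) = (s * s * (c * hnorm gi * hnorm gj)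
      + s * (s * (c * hnorm gi * Kj)) + s ^+ 2 * (c * Ki)) + s ^+ 2 * (c * Kj)); last first.
      by rewrite /K; move: (hnorm gi) (hnorm gj) => p q; ring.
    have bnd u v (a b : R) : 0 <= a -> hnorm u <= a -> hnorm v <= b ->
        nc (form u v) <= c * a * b.
      move=> a0 ua vb; apply: (le_trans (hc _ _)).
      apply: ler_pM => //; rewrite ?mulr_ge0 ?hnorm_ge0//.
      by rewrite ler_wpM2l.
    apply: lerD; last first.
      rewrite (_ : _ * (c * Kj) = c * 1 * (Kj * s ^+ 2)); last by ring.
      by apply: bnd; rewrite ?hnorm_ket.
    apply: (le_trans (ncD _ _)); apply: lerD; last first.
      rewrite (_ : _ * (c * Ki) = c * (Ki * s ^+ 2) * 1); last by ring.
      by apply: bnd; rewrite ?hnorm_displaced_ket// mulr_ge0 ?sqr_ge0.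
    apply: (le_trans (ncD _ _)); apply: lerD.
      rewrite !ncM !ncR (gtr0_norm s0) ler_wpM2l ?mulr_ge0//.
    rewrite ncM ncR (gtr0_norm s0) ler_wpM2l//.
    apply: (@le_trans _ _ (c * hnorm gi * (Kj * s ^+ 2))).
      by apply: bnd; rewrite ?hnorm_ge0.
    rewrite (_ : s * _ = c * hnorm gi * (Kj * s)); last by ring.
    rewrite ler_wpM2l ?mulr_ge0 ?hnorm_ge0// ler_wpM2l// expr2.
    by rewrite -[leRHS]mul1r ler_wpM2r.
  by rewrite ler_pM2l.
apply: nc_eq0_le => e e0.
have K1 : 0 < K + 1 by rewrite ltr_wpDl.
pose s := Num.min 1 (e / (K + 1)).
have s0 : 0 < s by rewrite lt_min ltr01 divr_gt0.
apply: (le_trans (Xs s s0 _)); first by rewrite ge_min lexx.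
apply: (@le_trans _ _ (e / (K + 1) * K)).
  by rewrite ler_wpM2r// /s ge_min lexx orbT.
rewrite mulrAC ler_pdivrMr// ler_wpM2l//; first exact: ltW.
by rewrite lerDl.
Qed.

(** [P] is the element between |j+1> and |j> of the commutator of the compressed operator with
    creation, and [Q] is minus that with annihilation. [form_skew] says w P + conj(w) Q = 0; w = 1
    gives P + Q = 0, w = i gives P = Q. *)
Lemma invariant_diag_succ j :
  form (ket R j.+1) (ket R j.+1) = form (ket R j) (ket R j).
Proof.
pose P := (Num.sqrt j.+1%:R)%:C * (form (ket R j.+1) (ket R j.+1)
   - form (ket R j) (ket R j)).
pose Q := (Num.sqrt j.+2%:R)%:C * form (ket R j.+2) (ket R j)
  - (Num.sqrt j%:R)%:C * form (ket R j.+1) (ket R j.-1).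
have wPQ w : w * P + conjc w * Q = 0.
  rewrite -(form_skew w j.+1 j) !term_vec1 formDl formDr formNl formNr.
  rewrite !formZl !formZr !conjcM !conjc_real conjcK /P /Q /=.
  move: (form (ket R j.+1) (ket R j.+1)) (form (ket R j) (ket R j))
    (form (ket R j.+2) (ket R j)) (form (ket R j.+1) (ket R j.-1)) => a b c d.
  by ring.
have h1 := wPQ 1; rewrite conjc1 !mul1r in h1.
have h2 := wPQ 'i%C.
have ci : conjc 'i%C = - 'i%C :> C by apply/eqP; rewrite eq_complex /= oppr0 !eqxx.
rewrite ci mulNr -mulrBr in h2.
have {}h2 : P - Q = 0.
  move/eqP: h2; rewrite mulf_eq0 => /orP[|/eqP//].
  by rewrite eq_complex /= oner_eq0 andbF.
have : 2 * P = 0 by rewrite -[RHS](addr0 0) -{1}h1 -h2; ring.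
move/eqP; rewrite mulf_eq0 pnatr_eq0 orFb mulf_eq0 (negPf (sqrt_succ_neq0 j)).
by rewrite orFb subr_eq0 => /eqP.
Qed.

Lemma invariant_diag_const x :
  inner (ket R (tuple_mk x t)) (A (ket R (tuple_mk x t))) =
  inner (ket R (tuple_mk 0 t)) (A (ket R (tuple_mk 0 t))).
Proof.
elim: x => [//|x <-].
by have := invariant_diag_succ x; rewrite /form !embed_ket.
Qed.

End Form.

Lemma unitary_bounded_adj (I : choiceType) (U : op R I) : unitary U ->
  [/\ bounded_op U, bounded_op (adj U), (forall u, adj U (U u) = u) &
   forall u, U (adj U u) = u].
Proof.
move=> [bU h1 h2]; split=> // [|u|u]; first exact: bounded_adj.
- by have /(congr1 (fun f => f u)) := h1.
- by have /(congr1 (fun f => f u)) := h2.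
Qed.

(** * Transport through the concentrating unitary *)

Section Concentrating.
Variable U : modes R m.+1.
Hypothesis hU : concentrating U.

Definition residual_state (t : J) : ell2 R L := adj U (ket R (tuple_mk 0 t)).

Lemma hnorm_residual_state t : hnorm (residual_state t) = 1.
Proof.
have [uU _ _ _] := hU; have [bU bU' UK KU] := unitary_bounded_adj uU.
by apply: inner_self_eq1; rewrite inner_adjr// KU orthonormal_ket eqxx.
Qed.

Lemma tensor_power_displacement (w : C) : tensor_power m.+1 (displacement w) =
  adj U \o @shift_first R m ((Num.sqrt m.+1%:R)%:C * w) \o U.
Proof.
have [uU _ _ /(_ w) h] := hU; have [bU bU' UK KU] := unitary_bounded_adj uU.
by rewrite /shift_first -h; apply/funext => u /=; rewrite !UK.
Qed.

(** Collective displacement by [w] becomes displacement of the first mode by [w] times the square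
    root of the number of modes; dividing by that nonzero factor reaches every displacement. *)
Lemma invariant_conj (M : modes R m.+1) : bounded_op M ->
  (forall w, adj (tensor_power m.+1 (displacement w)) \o M
     \o tensor_power m.+1 (displacement w) = M) ->
  forall w, adj (@shift_first R m w) \o (U \o M \o adj U) \o @shift_first R m w =
    U \o M \o adj U.
Proof.
move=> bM invM w.
have [uU _ _ _] := hU; have [bU bU' UK KU] := unitary_bounded_adj uU.
have [bW _ _] := shift_firstP m w.
have s0 := sqrt_succ_neq0 m.
have := invM ((Num.sqrt m.+1%:R)%:C^-1 * w).
rewrite tensor_power_displacement mulrA divff// mul1r.
have b1 : bounded_op (adj U \o @shift_first R m w) by exact: bounded_comp.
rewrite adj_comp// adj_comp// adjK// => h.
apply/funext => u /=; rewrite -[in RHS]h /=.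
by rewrite !KU.
Qed.

Lemma trace_invariant (M : modes R m.+1) : bounded_op M ->
  (forall w, adj (tensor_power m.+1 (displacement w)) \o M
     \o tensor_power m.+1 (displacement w) = M) ->
  forall (z : C) (N : R), 0 < N ->
  has_sum (fun t : J => (tuple_weight N t)%:C *
      inner (residual_state t) (M (residual_state t)))
    (trace (tensor_power m.+1 (displaced_thermal z N) \o M)).
Proof.
move=> bM invM z N N0.
have invA := invariant_conj bM invM.
have [uU _ /(_ z N N0) hrho _] := hU.
have [bU bU' UK KU] := unitary_bounded_adj uU.
pose w := (Num.sqrt m.+1%:R)%:C * z.
have [bW _ WW] := shift_firstP m w.
pose V := adj U \o @shift_first R m w.
have bV : bounded_op V by exact: bounded_comp.
have rhoE : tensor_power m.+1 (displaced_thermal z N) =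
    V \o diag (@tuple_weight R N m.+1) \o adj V.
  rewrite /V adj_comp// adjK//.
  rewrite -[LHS]/(id \o _ \o id); apply/funext => u /=.
  have := tensor_first_displaced_thermal m w N0; rewrite -hrho => h.
  have /(congr1 (fun f => f (U u))) /= := h.
  by rewrite UK => /(congr1 (adj U)); rewrite UK.
have bA : bounded_op (U \o M \o adj U) by do 2!apply: bounded_comp => //.
pose a t := inner (residual_state t) (M (residual_state t)).
(* Invariance removes the displacement contained in [V]; constancy of the diagonal then replaces [x]
   by the vacuum. *)
have aE x t : inner (V (ket R (tuple_mk x t))) (M (V (ket R (tuple_mk x t)))) = a t.
  rewrite /V /= inner_adjl//.
  have := invA w => /(congr1 (fun f => f (ket R (tuple_mk x t)))) /= h.
  rewrite -inner_adjr// h.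
  by rewrite (invariant_diag_const (A := U \o M \o adj U))//= -inner_adjl.
have p0 := fun l : L => tuple_weight_ge0 l N0.
have h := trace_mixture bV bM p0 (tuple_weight_fsum N0).
rewrite rhoE.
have {h} : has_sum (fun l : L => (thermal_weight N (tuple_hd l))%:C *
    ((tuple_weight N (tuple_tl l))%:C * a (tuple_tl l)))
    (trace (V \o diag (tuple_weight N (m:=m.+1)) \o adj V \o M)).
  apply: eq_has_sum h => l.
  by rewrite -[in inner _ _](tuple_mkK l) aE tuple_weight_split rmorphM mulrA.
move: (trace _) => T h.
have [c c0 hc] := bounded_opE bM.
have gb : sum_bound (fun t => (tuple_weight N t)%:C * a t) c.
  move=> X; apply: (@le_trans _ _ (\sum_(t <- X) tuple_weight N t * c)).
    apply: ler_sum => t _; rewrite ncM ncR ger0_norm ?tuple_weight_ge0//.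
    rewrite ler_wpM2l ?tuple_weight_ge0//.
    apply: (le_trans (inner_le _ _)); rewrite hnorm_residual_state mul1r.
    by apply: (le_trans (hc _)); rewrite hnorm_residual_state mulr1.
  rewrite -big_distrl /= -[leRHS]mul1r ler_wpM2r//.
  exact: tuple_weight_fsum.
(* The first mode now enters only through its thermal weight, and these weights sum to 1. *)
have := has_sum_split (@tuple_hdK m) (@tuple_tlK m) (@tuple_mkK m)
  (thermal_weight_bound N0) gb (thermal_weight_has_sum N0) (csumP gb).
move=> /has_sum_unique /(_ h); rewrite mul1r => <-.
exact: csumP gb.
Qed.

End Concentrating.
End Invariance.

(** * Photon-number sectors and outcome laws *)

Section Sectors.
Variable m : nat.
Local Notation J := (m.-tuple nat).

Definition photons (t : J) : nat := (\sum_(i < m) tnth t i)%N.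

(** Each entry of a tuple with [s] photons is at most [s], so enumerating tuples over ['I_s.+1]
    finds them all. *)
Definition sector (s : nat) : {fset J} :=
  [fset t in [seq t <- [seq map_tuple (@nat_of_ord s.+1) x |
     x <- enum {: m.-tuple 'I_s.+1}] | photons t == s]]%fset.

Lemma in_sector s t : (t \in sector s) = (photons t == s).
Proof.
rewrite inE /= mem_filter; case: eqP => //= ts; apply/mapP.
exists (map_tuple (fun k => inord k : 'I_s.+1) t); first by rewrite mem_enum.
apply: eq_from_tnth => i; rewrite !tnth_map inordK// ltnS -ts /photons.
by rewrite (bigD1 i)//= leq_addr.
Qed.

End Sectors.

(** All [s] photons can sit in one residual mode. This is where n >= 2 enters, making the averages
    over sectors meaningful. *)
Lemma sector_card_gt0 m s : (0 < #|` sector m.+1 s|)%N.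
Proof.
rewrite cardfs_gt0; apply/fset0Pn; exists (tuple_mk s (nseq_tuple m 0%N)).
rewrite in_sector /photons big_ord_recl tnth0 big1 ?addn0// => i _.
by rewrite tnthS tnth_nseq.
Qed.

Section SectorWeights.
Variables (R : realType) (m : nat).
Local Notation C := R[i].
Implicit Types (N : R) (s : nat).

Definition sector_weight N s : R := \sum_(t <- sector m s) tuple_weight N t.

Lemma tuple_weight_sector N s t : t \in sector m s ->
  tuple_weight N t = (N + 1)^-1 ^+ m * (N / (N + 1)) ^+ s.
Proof.
rewrite in_sector => /eqP <-; rewrite /tuple_weight /thermal_weight big_split /=.
by rewrite prodr_const card_ord -expr_sum.
Qed.

Lemma sector_weight_ge0 N s : 0 < N -> 0 <= sector_weight N s.
Proof. by move=> N0; apply: sumr_ge0 => t _; exact: tuple_weight_ge0. Qed.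

Lemma has_sum_sector (f : m.-tuple nat -> C) (c : R) (x : C) :
  sum_bound f c -> has_sum f x ->
  has_sum (fun s => \sum_(t <- sector m s) f t) x.
Proof.
move=> fc; apply: (has_sum_partition (h := @photons m) fc) => s.
rewrite big_seq (eq_bigr (fun t => f t *+ (photons t == s))); last first.
  by move=> t; rewrite in_sector => /eqP ->; rewrite eqxx.
rewrite -big_seq; apply: (has_sum_fin (f := fun t => f t *+ (photons t == s))) => t.
by rewrite in_sector => /negPf ->.
Qed.

Definition sector_mean (f : m.-tuple nat -> R) s : R :=
  (\sum_(t <- sector m s) f t) / #|` sector m s|%:R.

(** The weight is constant on a sector, so given [s] the tuple is uniformly distributed whatever [N]
    is: this is the sufficiency of the photon number. *)
Lemma sector_weight_mean (f : m.-tuple nat -> R) N s :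
  (0 < #|` sector m s|)%N ->
  \sum_(t <- sector m s) tuple_weight N t * f t =
  sector_weight N s * sector_mean f s.
Proof.
move=> c0; set w := (N + 1)^-1 ^+ m * (N / (N + 1)) ^+ s.
have -> : sector_weight N s = w * #|` sector m s|%:R.
  rewrite /sector_weight big_seq (eq_bigr (fun=> w)); last first.
    by move=> t; exact: tuple_weight_sector.
  by rewrite -big_seq big_const_seq count_predT iter_addr_0 mulr_natr.
rewrite /sector_mean mulrAC -mulrA mulfVK ?pnatr_eq0 -?lt0n//.
rewrite big_seq (eq_bigr (fun t => w * f t)); last first.
  by move=> t ts; rewrite (tuple_weight_sector _ ts).
by rewrite -big_seq big_distrr.
Qed.

End SectorWeights.

(** * Probabilities from real-valued set functions, and their mixtures *)

Section RealMeasures.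
Variable R : realType.

Lemma nneseries_has_sum (g : nat -> R) (x : R) : (forall s, 0 <= g s) ->
  has_sum (fun s => (g s)%:C) x%:C ->
  (\sum_(0 <= s <oo) (g s)%:E)%E = x%:E.
Proof.
move=> g0 gx; rewrite nneseries_esumT; last by move=> s; rewrite lee_fin.
have [Sf h] := @has_sum_nonneg R nat g x g0 (fun X => has_sum_fsum_le X g0 gx).
rewrite -(fineK Sf); congr (_%:E).
by have /(congr1 (@complex.Re R)) := has_sum_unique h gx.
Qed.

Lemma real_probability d (Y : measurableType d) (phi : set Y -> R) :
  (forall B, measurable B -> 0 <= phi B) -> phi setT = 1 ->
  (forall F : nat -> set Y, (forall i, measurable (F i)) -> trivIset setT F ->
    series (fun i => phi (F i)) @ \oo --> phi (\bigcup_i F i)) ->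
  exists P : probability Y R, forall B, measurable B -> P B = (phi B)%:E.
Proof.
move=> phi0 phi1 phis.
(* [phi] is controlled on measurable sets only, so a nonnegative default is used elsewhere. *)
pose mu (B : set Y) : \bar R := if `[< measurable B >] then (phi B)%:E else 0%E.
have muE B : measurable B -> mu B = (phi B)%:E.
  by move=> mB; rewrite /mu; case: asboolP.
(* The series with constant term [phi set0] converges, so its term tends to 0. *)
have phi00 : phi set0 = 0.
  have := phis (fun=> set0) (fun=> measurable0) (ltac:(by move=> i j _ _ [? []])).
  rewrite bigcup0// => h.
  have := @cvg_series_cvg_0 _ _ _ (ltac:(by apply: cvgP h)).
  by move=> /(cvg_lim (@Rhausdorff R)) <-; rewrite lim_cst//; exact: Rhausdorff.
have mu0 : mu set0 = 0%E by rewrite muE ?phi00.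
have mu_ge0 B : (0 <= mu B)%E.
  by rewrite /mu; case: asboolP => // mB; rewrite lee_fin phi0.
have mu_sigma : semi_sigma_additive mu.
  move=> F mF tF mUF; rewrite muE//.
  have -> : (fun n => (\sum_(0 <= i < n) mu (F i))%E) =
     EFin \o series (fun i => phi (F i)).
    by apply/funext => n /=; rewrite -sumEFin; apply: eq_bigr => i _; rewrite muE.
  by apply: cvg_EFin; [exact: nearW|exact: phis].
have mu1 : mu setT = 1%E by rewrite muE ?phi1.
pose mmix := isMeasure.Build d Y R mu mu0 mu_ge0 mu_sigma.
pose mm : {measure set Y -> \bar R} := HB.pack mu mmix.
pose pmix := Measure_isProbability.Build d Y R mm mu1.
pose P : probability Y R := HB.pack (Measure.sort mm) pmix.
by exists P => B mB; exact: muE.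
Qed.

(** The integral formula is what lets a kernel be integrated against the law of the residual number,
    a mixture of Dirac masses. *)
Lemma probability_mixture d (Y : measurableType d) (P : nat -> probability Y R)
    (w : nat -> {nonneg R}) :
  has_sum (fun s => ((w s)%:num)%:C) (1 : R[i]) ->
  exists Q : probability Y R,
    (forall B, measurable B -> Q B = (\sum_(0 <= s <oo) (w s)%:num%:E * P s B)%E) /\
    forall f : Y -> \bar R, measurable_fun [set: Y] f -> (forall y, 0 <= f y)%E ->
      (\int[Q]_y f y = \sum_(0 <= s <oo) (w s)%:num%:E * \int[P s]_y f y)%E.
Proof.
move=> w1; pose Q := mseries (fun s => mscale (w s) (P s)) 0.
have Q1 : Q setT = 1%E.
  rewrite /Q /mseries /= /mscale.
  rewrite (eq_eseriesr (g := fun s => ((w s)%:num)%:E)).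
    exact: nneseries_has_sum w1.
  by move=> s _; rewrite /= probability_setT mule1.
pose pmix := Measure_isProbability.Build d Y R Q Q1.
pose P' : probability Y R := HB.pack (Measure.sort Q) pmix.
exists P'; split=> // f mf f0.
transitivity (\int[Q]_y f y)%E; first by [].
rewrite ge0_integral_measure_series//; apply: eq_eseriesr => s _.
by rewrite ge0_integral_mscale.
Qed.

End RealMeasures.

Section DiagonalOperators.
Variables (R : realType) (I : choiceType).
Local Notation nc := (@ComplexField.Normc.normc R).
Implicit Types u v : ell2 R I.

Lemma diag_selfadjoint (q : I -> R) (K : R) u v : (forall i, `|q i| <= K) ->
  inner (diag q u) v = inner u (diag q v).
Proof.
move=> qK; apply: has_sum_unique (inner_has_sum _ _) _.
apply: eq_has_sum (inner_has_sum u (diag q v)) => i.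
by rewrite !(diagE _ _ qK) conjcM conjc_real; ring.
Qed.

(** The indicator operator is idempotent and self-adjoint, so the form is a squared norm. *)
Lemma diag_indicator_positive (P : pred I) u :
  0 <= inner u (diag (fun i => (P i)%:R : R) u).
Proof.
have qK i : `|(P i)%:R : R| <= 1 by case: (P i); rewrite ?normr0 ?normr1.
have -> : diag (fun i => (P i)%:R : R) u =
    diag (fun i => (P i)%:R : R) (diag (fun i => (P i)%:R : R) u).
  by apply: ell2P => i; rewrite !(diagE _ _ qK); case: (P i); rewrite /= ?mul1r ?mul0r.
by rewrite -(diag_selfadjoint _ _ qK) inner_self lecE /= eqxx sqr_ge0.
Qed.

Lemma diag_const1 : diag (fun _ : I => 1 : R) = id.
Proof.
apply/funext => u; apply: ell2P => i.
by rewrite (diagE (K := 1)) ?mul1r// => j; rewrite normr1.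
Qed.

(** By disjointness each index lies in at most one [F k], so the double family has the
    Cauchy-Schwarz bound of a single inner product and Fubini applies. *)
Lemma diag_indicator_series (J : choiceType) (h : I -> J) (F : nat -> set J) u v :
  trivIset setT F ->
  series (fun k => (inner u (diag (fun i => `[< F k (h i) >]%:R : R) v) : R[i]^o))
    @ \oo --> (inner u (diag (fun i => `[< (\bigcup_k F k) (h i) >]%:R : R) v) : R[i]^o).
Proof.
move=> tF; apply: has_sum_series.
have qK (S : set J) i : `| (`[< S (h i) >]%:R : R) | <= 1.
  by case: `[< _ >]; rewrite ?normr0 ?normr1.
pose f i := conjc (u i) * v i.
have fS (S : set J) : has_sum (fun i => f i *+ `[< S (h i) >])
    (inner u (diag (fun i => `[< S (h i) >]%:R : R) v)).
  apply: eq_has_sum (inner_has_sum _ _) => i; rewrite (diagE _ _ (qK S)) /f.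
  by case: `[< _ >]; rewrite /= ?mul1r ?mul0r ?mulr0.
apply: (@fubini _ _ _ (fun i k => f i *+ `[< F k (h i) >])
  (fun i => f i *+ `[< (\bigcup_k F k) (h i) >]) _ _ (hnorm u * hnorm v)) => //.
  move=> X Y; apply: le_trans (cauchy_schwarz_bound u v X); apply: ler_sum => i _.
  have [[k0 Fk0]|no] := pselect (exists k, F k (h i)).
    rewrite (eq_bigr (fun k => nc (f i) *+ (k == k0))).
      by rewrite fsum_pred1; case: (_ \in _); rewrite ?mulr0n ?nc_ge0.
    move=> k _; have -> : `[< F k (h i) >] = (k == k0).
      apply/asboolP/eqP => [Fk|->//].
      by apply: tF => //; exists (h i).
    by case: eqP; rewrite ?mulr0n ?nc0.
  rewrite big1 ?nc_ge0// => k _; case: asboolP => [Fk|_]; last by rewrite nc0.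
  by exfalso; apply: no; exists k.
move=> i; have [[k0 Fk0]|no] := pselect (exists k, F k (h i)).
  have := @has_sum1 _ _ (fun k => f i *+ `[< F k (h i) >]) k0.
  rewrite !asboolT//; last by exists k0.
  apply=> k /eqP kk0; rewrite asboolF// => Fk; apply: kk0.
  by apply: tF => //; exists (h i).
rewrite asboolF; last by case=> k _ Fk; apply: no; exists k.
apply: eq_has_sum (@has_sum0 _ _) => k.
by rewrite asboolF// => Fk; apply: no; exists k.
Qed.

End DiagonalOperators.

(** The discrete metric: Cauchy sequences are eventually constant and every set is open. *)
Lemma standard_borel_nat (R : realType) : standard_borel R nat.
Proof.
exists (fun x y => (x != y)%:R); split.
- split; first by move=> x y; case: eqP => //= xy; split=> // /eqP; rewrite oner_eq0.
  split; first by move=> x y; rewrite eq_sym.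
  move=> x y z; case: (eqVneq x y) => [->|]; first by rewrite add0r.
  by move=> _; case: (x != z); rewrite /= ?addr_ge0// lerDl.
- move=> x /(_ 1 ltr01) [N hN]; exists (x N) => e e0; exists N => i Ni.
  have := hN i N Ni (leqnn N); by case: eqP => //=; rewrite ltxx.
- exists setT; first exact: countableP.
  by move=> x e e0; exists x => //; rewrite eqxx.
- apply/seteqP; split=> // V _; apply: sub_sigma_algebra => x Vx.
  by exists 1 => // y /=; case: eqP => [<-//|_]; rewrite /= ltxx.
Qed.

(** * The residual photon-number measurement belongs to the class *)

Section Residual.
Variables (R : realType) (m : nat) (U : modes R m.+1).
Hypothesis hU : concentrating U.
Local Notation C := R[i].

Lemma residual_numberE (S : set nat) :
  residual_number U S = adj U \o diag (@tail_indicator R m S) \o U.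
Proof. by rewrite -tensor_first_number_proj. Qed.

Lemma bounded_residual (S : set nat) : bounded_op (residual_number U S).
Proof.
have [uU _ _ _] := hU; have [bU bU' UK KU] := unitary_bounded_adj uU.
rewrite residual_numberE; apply: bounded_comp => //; apply: bounded_comp => //.
exact: diag_bounded (@tail_indicator_le1 R m S).
Qed.

Lemma residual_povm : povm (residual_number U).
Proof.
have [uU _ _ _] := hU; have [bU bU' UK KU] := unitary_bounded_adj uU.
split.
- exact: standard_borel_nat.
- move=> S _; split=> [|u]; first exact: bounded_residual.
  by rewrite residual_numberE /= inner_adjr// diag_indicator_positive.
- rewrite residual_numberE /tail_indicator.
  have -> : (fun l : m.+1.-tuple nat => `[< [set: nat] (\sum_(i < m) tnth (tuple_tl l) i)%N >]%:R : R)
     = (fun=> 1) by apply/funext => l; rewrite asboolT.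
  by rewrite diag_const1; apply/funext => u /=.
- move=> F _ tF u v.
  have := @diag_indicator_series R _ nat (fun l : m.+1.-tuple nat => photons (tuple_tl l))
    F (U u) (U v) tF.
  have E S : inner (U u) (diag (fun l : m.+1.-tuple nat => `[< S (photons (tuple_tl l)) >]%:R : R) (U v))
     = inner u (residual_number U S v) by rewrite residual_numberE /= inner_adjr.
  by rewrite E; under [X in series X]eq_fun do rewrite E.
Qed.

(** The indicator acts as a scalar on each slice with fixed tail, and a displacement of the first
    mode preserves slices. *)
Lemma shift_first_tail_indicator w (S : set nat) :
  adj (@shift_first R m w) \o diag (@tail_indicator R m S) \o @shift_first R m w =
  diag (@tail_indicator R m S).
Proof.
have [bW Wk WW] := shift_firstP m w.
have ind1 := @tail_indicator_le1 R m S.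
have bdiag := diag_bounded ind1.
apply: op_ext => //.
  by apply: bounded_comp => //; apply: bounded_comp => //; exact: bounded_adj.
move=> k l /=; rewrite inner_adjr// !Wk.
have -> : diag (tail_indicator R S) (embed (tuple_tl l) (displaced_ket w (tuple_hd l)))
   = (tail_indicator R S l)%:C *: embed (tuple_tl l) (displaced_ket w (tuple_hd l)).
  rewrite (diag_embed (a := tail_indicator R S l) (p := fun=> 1) (c := 1) _ ind1).
  - by rewrite diag_const1.
  - by move=> x; rewrite normr1.
  - by move=> l' e; rewrite mul1r /tail_indicator e.
have WWk u : adj (@shift_first R m w) (shift_first w u) = u.
  by have /(congr1 (fun f => f u)) := WW.
by rewrite (diag_ket _ ind1) !innerZr -!Wk -(inner_adjr _ _ bW) WWk.
Qed.

Lemma residual_invariant (w : C) (S : set nat) :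
  adj (tensor_power m.+1 (displacement w)) \o residual_number U S
    \o tensor_power m.+1 (displacement w) = residual_number U S.
Proof.
have [uU _ _ _] := hU; have [bU bU' UK KU] := unitary_bounded_adj uU.
rewrite residual_numberE (tensor_power_displacement hU).
set w' := _ * w; have [bW _ _] := shift_firstP m w'.
rewrite adj_comp//; last exact: bounded_comp.
rewrite adj_comp// adjK// -[in RHS](shift_first_tail_indicator w' S).
by apply/funext => u /=; rewrite !KU.
Qed.

Lemma residual_state_residual (t : m.-tuple nat) (S : set nat) :
  inner (residual_state U t) (residual_number U S (residual_state U t)) =
  (`[< S (photons t) >]%:R)%:C.
Proof.
have [uU _ _ _] := hU; have [bU bU' UK KU] := unitary_bounded_adj uU.
rewrite residual_numberE /= inner_adjr// KU (diag_ket _ (@tail_indicator_le1 R m S)).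
by rewrite innerZr orthonormal_ket eqxx mulr1 /tail_indicator tuple_tlK.
Qed.

End Residual.

Lemma has_sum_real (R : realType) (I : choiceType) (g : I -> R) (x : R[i]) :
  has_sum (fun i => (g i)%:C) x -> x = (complex.Re x)%:C.
Proof.
move=> gx; have : conjc x = x.
  apply: has_sum_unique (has_sumJ gx) _.
  by apply: eq_has_sum gx => i; rewrite conjc_real.
case: x {gx} => a b [] /= /eqP; rewrite eq_sym -subr_eq0 opprK -mulr2n mulrn_eq0 /=.
by move=> /eqP ->.
Qed.

Lemma cvg_Re (R : realType) (f : nat -> R[i]) (x : R[i]) :
  (f : nat -> R[i]^o) @ \oo --> (x : R[i]^o) ->
  (fun n => complex.Re (f n)) @ \oo --> complex.Re x.
Proof.
move=> /cvgrPdist_le fx; apply/cvgrPdist_le => e e0.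
have e0' : 0 < e%:C :> R[i] by rewrite ltcE /= eqxx.
have [N _ hN] := fx _ e0'; exists N => // n /hN h.
have {}h : (ComplexField.Normc.normc (x - f n))%:C <= e%:C :> R[i] := h.
move: h; rewrite lecE /= eqxx /= => h; apply: le_trans h.
apply: le_trans (nc_Re _); rewrite complexD_Re.
by case: (f n).
Qed.

Lemma cvg_seq_sum (R : realType) (T : Type) (r : seq T) (f : T -> nat -> R) (l : T -> R) :
  (forall t, f t @ \oo --> l t) ->
  (fun n => \sum_(t <- r) f t n) @ \oo --> \sum_(t <- r) l t.
Proof.
move=> h; elim: r => [|t r IH].
  by under eq_fun do rewrite big_nil; rewrite big_nil; exact: cvg_cst.
by under eq_fun do rewrite big_cons; rewrite big_cons; exact: cvgD.
Qed.

(** * The kernel and the outcome laws *)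

Section SectorLaws.
Variables (R : realType) (m : nat) (U : modes R m.+2).
Hypothesis hU : concentrating U.
Local Notation C := R[i].
Local Notation n := m.+2.

(** For [A = M B] this is the kernel value K(s, B); no state of the family occurs in it. *)
Definition residual_law (A : modes R n) (s : nat) : R :=
  sector_mean (fun t : m.+1.-tuple nat =>
    complex.Re (inner (residual_state U t) (A (residual_state U t)))) s.

Definition displacement_invariant (A : modes R n) : Prop :=
  forall w, adj (tensor_power n (displacement w)) \o A
    \o tensor_power n (displacement w) = A.

Lemma trace_residual_law (A : modes R n) (z : C) (N : R) :
  bounded_op A -> positive_op A -> displacement_invariant A -> 0 < N ->
  has_sum (fun s => (sector_weight m.+1 N s * residual_law A s)%:C)
    (trace (tensor_power n (displaced_thermal z N) \o A)).
Proof.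
move=> bA pA iA N0.
have h := trace_invariant hU bA iA z N0.
pose a t := complex.Re (inner (residual_state U t) (A (residual_state U t))).
(* Positivity in [R[i]] includes reality, so taking real parts loses nothing. *)
have aE t : inner (residual_state U t) (A (residual_state U t)) = (a t)%:C.
  rewrite /a; have := pA (residual_state U t); rewrite lecE => /andP[/eqP im _].
  by move: im; case: (inner _ _) => x y /= ->.
pose f t := (tuple_weight N t * a t)%:C : C.
have {}h : has_sum f (trace (tensor_power n (displaced_thermal z N) \o A)).
  by apply: eq_has_sum h => t; rewrite aE -rmorphM.
have [c c0 hc] := bounded_opE bA.
have fb : sum_bound f c.
  apply: (sum_bound_le (g := fun t => tuple_weight N t * c)) => [t|X].
    rewrite ncR normrM ger0_norm ?tuple_weight_ge0// ler_wpM2l ?tuple_weight_ge0//.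
    apply: (le_trans (nc_Re _)); apply: (le_trans (inner_le _ _)).
    by rewrite (hnorm_residual_state hU) mul1r (le_trans (hc _))// (hnorm_residual_state hU) mulr1.
  by rewrite -big_distrl /= -[leRHS]mul1r ler_wpM2r// tuple_weight_fsum.
apply: eq_has_sum (has_sum_sector fb h) => s.
by rewrite -rmorph_sum -sector_weight_mean// sector_card_gt0.
Qed.

(** For the residual measurement itself the kernel is the Dirac one; its outcome law is thus given
    by the sector weights. *)
Lemma residual_law_residual (S : set nat) s :
  residual_law (residual_number U S) s = `[< S s >]%:R.
Proof.
have c0 : #|` sector m.+1 s|%:R != 0 :> R by rewrite pnatr_eq0 -lt0n sector_card_gt0.
rewrite /residual_law /sector_mean big_seq (eq_bigr (fun=> `[< S s >]%:R)).
  by rewrite -big_seq big_const_seq count_predT iter_addr_0 -[_ *+ size _]mulr_natr mulfK.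
move=> t; rewrite in_sector => /eqP ts.
by rewrite (residual_state_residual hU) /= ts.
Qed.

Lemma residual_law_probability d (Y : measurableType d) (M : set Y -> modes R n) s :
  povm M ->
  exists P : probability Y R, forall B, measurable B -> P B = (residual_law (M B) s)%:E.
Proof.
move=> [_ hM M1 Msig]; apply: real_probability.
- move=> B mB; apply: divr_ge0 => //; apply: sumr_ge0 => t _.
  by have := (hM B mB).2 (residual_state U t); rewrite lecE => /andP[].
- have c0 : #|` sector m.+1 s|%:R != 0 :> R by rewrite pnatr_eq0 -lt0n sector_card_gt0.
  rewrite /residual_law /sector_mean M1 (eq_bigr (fun=> 1)).
    by rewrite big_const_seq count_predT iter_addr_0 divff.
  by move=> t _; rewrite inner_self (hnorm_residual_state hU) expr1n.
- move=> F mF tF; rewrite /residual_law /sector_mean.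
  rewrite (_ : series _ = fun k => (\sum_(t <- sector m.+1 s)
     complex.Re (series (fun i => inner (residual_state U t)
        (M (F i) (residual_state U t))) k)) / #|` sector m.+1 s|%:R); last first.
    apply/funext => k; rewrite /series /= -big_distrl /= exchange_big /=; congr (_ / _).
    apply: eq_bigr => t _; elim/big_ind2: _ => // x y x' y' -> ->.
    by rewrite complexD_Re.
  apply: cvgMl; apply: cvg_seq_sum => t.
  exact: (cvg_Re (Msig F mF tF _ _)).
Qed.

(** Stated for an arbitrary invariant POVM so as to serve both the residual measurement, with Dirac
    masses for [P], and the given [M]. *)
Lemma mixture_outcome_law d (Y : measurableType d) (M : set Y -> modes R n)
    (P : nat -> probability Y R) (Q : probability Y R) (z : C) (N : R) :
  povm M -> (forall B, measurable B -> displacement_invariant (M B)) -> 0 < N ->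
  (forall s B, measurable B -> P s B = (residual_law (M B) s)%:E) ->
  (forall B, measurable B ->
    Q B = (\sum_(0 <= s <oo) (sector_weight m.+1 N s)%:E * P s B)%E) ->
  outcome_law (tensor_power n (displaced_thermal z N)) M Q.
Proof.
move=> [_ hM _ _] iM N0 PE QE B mB; have [bM pM] := hM B mB.
have h := trace_residual_law z bM pM (iM B mB) N0.
have e := has_sum_real h; rewrite e; rewrite e in h; congr (_%:C); rewrite QE//.
rewrite (eq_eseriesr (g := fun s => (sector_weight m.+1 N s * residual_law (M B) s)%:E)).
  rewrite (nneseries_has_sum _ h)// => s; apply: mulr_ge0; first exact: sector_weight_ge0.
  by rewrite -lee_fin -PE.
by move=> s _; rewrite PE.
Qed.

End SectorLaws.

Lemma residual_in_class (R : realType) (m : nat) (U : modes R m.+1) :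
  concentrating U -> invariant_povm (residual_number U).
Proof.
move=> hU; split; first exact: residual_povm.
by move=> w S _; exact: residual_invariant.
Qed.

Lemma measurable_from_nat d (T : measurableType d) (f : nat -> T) :
  measurable_fun [set: nat] f.
Proof. by []. Qed.

Theorem theorem6p3 (R : realType) (n : nat) (hn : (2 <= n)%N) (U : modes R n)
    (hU : concentrating U) :
  qc_sufficient (displaced_thermal_family n) (@invariant_povm R n)
    (residual_number U) /\
  forall (d : measure_display) (Y : measurableType d) (M : set Y -> modes R n),
    invariant_povm M ->
    exists K : R.-pker nat ~> Y,
      forall (z : R[i]) (N : R) (B : set Y), 0 < N -> measurable B ->
        series (fun s : nat => ((fine (K s B))%:C *
          trace (tensor_power n (displaced_thermal z N) \o
                 residual_number U [set s]) : R[i]^o)) @ \oo -->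
        (trace (tensor_power n (displaced_thermal z N) \o M B) : R[i]^o).
Proof.
case: n hn U hU => [|[|m]]// _ U hU.
have resC := residual_in_class hU.
have kernelP d (Y : measurableType d) (M : set Y -> modes R m.+2) :
    invariant_povm M -> exists P : nat -> pprobability Y R,
    forall s B, measurable B -> P s B = (residual_law U (M B) s)%:E.
  move=> [pM _]; have [P hP] := choice (fun s => @residual_law_probability R m U hU d Y M s pM).
  by exists P.
(* The same kernel serves both assertions: it is chosen from [M] before any state is introduced. *)
split; [split=> //|] => d Y M MC; have [P PE] := kernelP d Y M MC;
  exists (kprobability (measurable_from_nat P)).
  move=> _ [z [N [N0 ->]]].
  pose w s : {nonneg R} := NngNum (sector_weight_ge0 m.+1 s N0).
  have w1 : has_sum (fun s => ((w s)%:num)%:C) (1 : R[i]).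
    have [b1 h1] := tuple_weight_sum m.+1 N0.
    by apply: eq_has_sum (has_sum_sector b1 h1) => s; rewrite -rmorph_sum.
  (* Both laws are mixtures with the sector weights, of Dirac masses and of the [P s]; integrating
     the kernel against a Dirac mass returns [P s]. *)
  have [mu [muE muI]] := probability_mixture (fun s : nat => \d_s : probability nat R) w1.
  have [nu [nuE _]] := probability_mixture (P : nat -> probability Y R) w1.
  exists mu, nu; split.
  - apply: (mixture_outcome_law hU z resC.1 _ N0 _ muE).
      by move=> B mB w'; exact: resC.2.
    move=> s B mB; rewrite (residual_law_residual hU) /= diracE.
    suff -> : (s \in B) = `[< B s >] by [].
    by apply/idP/idP => [/set_mem/asboolT //|/asboolW/mem_set].
  - apply: (mixture_outcome_law (P := P) hU z MC.1 _ N0 PE nuE).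
    by move=> B mB w'; exact: MC.2.
  - move=> B mB; rewrite nuE// muI//.
    apply: eq_eseriesr => s _; congr (_ * _)%E.
    by rewrite integral_dirac// diracT mul1e.
move=> z N B N0 mB; apply: has_sum_series.
have [[_ hM _ _] iM] := MC; have [bM pM] := hM B mB.
have h := trace_residual_law hU z bM pM (fun w => iM w B mB) N0.
apply: eq_has_sum h => s.
(* Only the [s]-th term survives in the expansion for [[set s]], so the trace against
   [residual_number U [set s]] is the sector weight. *)
have [[_ hR _ _] iR] := resC; have [bR pR] := hR [set s] I.
have h1 := trace_residual_law hU z bR pR (fun w => iR w [set s] I) N0.
have -> : kprobability (measurable_from_nat P) s B = (residual_law U (M B) s)%:E.
  exact: PE.
rewrite mulrC rmorphM; congr (_ * _).
apply: has_sum_unique h1 => //.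
have := @has_sum1 R nat (fun s' => (sector_weight m.+1 N s' *
  residual_law U (residual_number U [set s]) s')%:C) s.
rewrite (residual_law_residual hU) asboolT// mulr1; apply=> s' /eqP ss'.
by rewrite (residual_law_residual hU) asboolF ?mulr0.
Qed.
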